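(* Let $X$ be a compact connected smooth manifold without boundary, of dimension $\dim X > 1$, and let $d$ be a distance on $X$ inducing the topology of $X$ and such that $X$ admits a finite atlas of smooth charts which are bi-Lipschitz with respect to $d$ and the norm of $\mathbb{R}^{\dim X}$. Then there exists a Baire residual subset $\mathfrak{R}$ of the metric space $(\mathrm{Homeo}(X,d), D)$ such that $$\overline{\mathrm{mdim}_M}\,(X,f,d) = \dim X \qquad \text{for every } f \in \mathfrak{R}.$$
   Context: $\mathrm{Homeo}(X,d)$ is the set of homeomorphisms of $X$, endowed with the (complete) metric $D(f,g)= \max_{x\in X}\max\{d(f(x),g(x)),\,d(f^{-1}(x),g^{-1}(x))\}$; its topology is called the $C^0$-topology. A subset is Baire residual if it contains a countable intersection of open dense subsets. Upper metric mean dimension: for a continuous map $f: X\to X$ and $n\in\mathbb{N}$, let $d_n(x,y)=\max_{0\leqslant j\leqslant n-1} d(f^j(x),f^j(y))$. Given $\varepsilon>0$, a set $A\subset X$ is $(n,\varepsilon)$-separated by $f$ if $d_n(x,y)>\varepsilon$ for all distinct $x,y\in A$; $s(f,n,\varepsilon)$ denotes the maximal cardinality of an $(n,\varepsilon)$-separated subset of $X$ (finite by compactness). Put $h(f,\varepsilon)=\limsup_{n\to+\infty}\frac1n\log s(f,n,\varepsilon)$ and $$\overline{\mathrm{mdim}_M}\,(X,f,d)=\limsup_{\varepsilon\to 0^+}\frac{h(f,\varepsilon)}{|\log\varepsilon|}.$$ *)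

(* Defs.v *)
From HB Require Import structures.
From mathcomp Require Import all_boot all_order all_algebra finmap.
From mathcomp Require Import all_classical all_reals all_analysis.
From mathcomp Require Import lra.

Set Implicit Arguments.
Unset Strict Implicit.
Unset Printing Implicit Defensive.

Import Order.TTheory GRing.Theory Num.Theory.
Import numFieldNormedType.Exports.

Local Open Scope classical_set_scope.
Local Open Scope ring_scope.

(* U is meant to be open: the derivatives at points of U then depend only on
   the values of f on U. In finite dimension this is the usual class C^k. *)
Fixpoint Ck_on (R : realType) (V W : normedModType R) (k : nat) (U : set V)
    (f : V -> W) : Prop :=
  match k with
  | 0%N => forall x, U x -> {for x, continuous f}
  | k'.+1 => (forall x, U x -> differentiable f x) /\
             forall v : V, Ck_on k' U (fun x => 'D_v f x)
  end.

Definition smooth_on (R : realType) (V W : normedModType R) (U : set V)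
    (f : V -> W) : Prop :=
  forall k, Ck_on k U f.

(* The values of chart_map outside chart_dom, and of chart_inv outside the
   image of chart_dom, are irrelevant. *)
Record chart (R : realType) (X : topologicalType) (n : nat) := Chart {
  chart_dom : set X ;
  chart_map : X -> 'rV[R]_n ;
  chart_inv : 'rV[R]_n -> X ;
  chart_dom_open : open chart_dom ;
  chart_img_open : open (chart_map @` chart_dom) ;
  chart_map_continuous : {within chart_dom, continuous chart_map} ;
  chart_inv_continuous :
    {within chart_map @` chart_dom, continuous chart_inv} ;
  chart_mapK : forall x, chart_dom x -> chart_inv (chart_map x) = x
}.

Section SmoothStructure.
Context {R : realType} {X : topologicalType} {n : nat}.
Implicit Types (phi psi : chart R X n) (A F : set (chart R X n)).

Definition smooth_transition phi psi : Prop :=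
  smooth_on (chart_map phi @` (chart_dom phi `&` chart_dom psi))
            (chart_map psi \o chart_inv phi).

Definition smooth_compatible phi psi : Prop :=
  smooth_transition phi psi /\ smooth_transition psi phi.

Definition charts_cover A : Prop :=
  \bigcup_(phi in A) chart_dom phi = [set: X].

Definition smooth_atlas A : Prop :=
  charts_cover A /\
  forall phi psi, A phi -> A psi -> smooth_compatible phi psi.

(* The maximal atlas of the smooth structure determined by A. *)
Definition smooth_charts A : set (chart R X n) :=
  [set phi | forall psi, A psi -> smooth_compatible phi psi].

End SmoothStructure.

(* `|_| is the sup norm of R^n; any other norm changes only the constant L. *)
Definition bilipschitz_chart (R : realType) (X : metricType R) (n : nat)
    (phi : chart R X n) : Prop :=
  exists2 L : R, 0 < L & forall x y, chart_dom phi x -> chart_dom phi y ->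
    L^-1 * mdist x y <= `|chart_map phi x - chart_map phi y| <= L * mdist x y.

Definition bilipschitz_smooth_atlas (R : realType) (X : metricType R) (n : nat)
    (A F : set (chart R X n)) : Prop :=
  [/\ finite_set F, F `<=` smooth_charts A, charts_cover F &
      forall phi, F phi -> bilipschitz_chart phi].

(* Compactness is a parameter of the type because it makes the supremum
   defining homeo_dist finite, hence homeo_dist a distance. *)
Record Homeo (R : realType) (X : metricType R) (cX : compact [set: X]) :=
  MkHomeo {
    homeo_fun :> X -> X ;
    homeo_inv : X -> X ;
    homeo_fun_continuous : continuous homeo_fun ;
    homeo_inv_continuous : continuous homeo_inv ;
    homeo_funK : cancel homeo_fun homeo_inv ;
    homeo_invK : cancel homeo_inv homeo_fun
  }.

Definition homeo_dist (R : realType) (X : metricType R)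
    (cX : compact [set: X]) (f g : Homeo cX) : R :=
  sup [set Num.max (mdist (f x) (g x)) (mdist (homeo_inv f x) (homeo_inv g x))
      | x in [set: X]].

Section HomeoMetric.
Context (R : realType) (X : metricType R) (cX : compact [set: X]).
Implicit Types f g h : Homeo cX.

Let dst f g (x : X) : R :=
  Num.max (mdist (f x) (g x)) (mdist (homeo_inv f x) (homeo_inv g x)).

Lemma compact_mdist_bounded : exists M : R, forall x y : X, mdist x y <= M.
Proof.
have [[x0 _]|X0] := pselect (exists x : X, True); last first.
  by exists 0 => x; exfalso; apply: X0; exists x.
have ct : continuous (mdist x0 : X -> R).
  move=> y; apply/cvgrPdist_lt => e e0.
  have : nbhs y (ball y e) by exact: nbhsx_ballx.
  apply: filterS => z; rewrite ballEmdist /= => yz.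
  have h1 := metric_triangle x0 y z; have h2 := metric_triangle x0 z y.
  rewrite (metric_sym z y) in h2.
  by rewrite ltr_norml ltrBrDr ltrBlDr; apply/andP; split; lra.
have cK : compact (mdist x0 @` [set: X]).
  apply: continuous_compact => //; exact: continuous_subspaceT.
have [M HM] : has_ubound (mdist x0 @` [set: X]).
  by apply: (compact_has_sup _ cK).2; exists (mdist x0 x0), x0.
exists (M + M) => x y; apply: le_trans (metric_triangle x x0 y) _.
by rewrite (metric_sym x x0); apply: lerD; apply: HM; eexists.
Qed.

Let dst_ub f g : has_ubound (range (dst f g)).
Proof.
have [M HM] := compact_mdist_bounded.
by exists M => _ [x _ <-]; rewrite /dst ge_max !HM.
Qed.

Lemma homeo_dist_ge f g x :
  mdist (f x) (g x) <= homeo_dist f g /\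
  mdist (homeo_inv f x) (homeo_inv g x) <= homeo_dist f g.
Proof.
have : dst f g x <= homeo_dist f g 
  by apply: sup_ubound; [exact: dst_ub | exists x].
by rewrite /dst ge_max => /andP[].
Qed.

Let homeo_dist_le f g (M : R) : 0 <= M ->
  (forall x, dst f g x <= M) -> homeo_dist f g <= M.
Proof.
move=> M0 HM; have [[x0 _]|X0] := pselect (exists x : X, True).
  apply: ge_sup => [|_ [x _ <-]]; last exact: HM.
  by exists (dst f g x0), x0.
rewrite /homeo_dist (_ : image _ _ = set0) ?sup0// -subset0.
by move=> r [x _ _]; apply: X0; exists x.
Qed.

Let homeo_dist_ge0 f g : 0 <= homeo_dist f g.
Proof.
have [[x0 _]|X0] := pselect (exists x : X, True).
  exact: le_trans (mdist_ge0 _ _) (homeo_dist_ge f g x0).1.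
rewrite /homeo_dist (_ : image _ _ = set0) ?sup0// -subset0.
by move=> r [x _ _]; apply: X0; exists x.
Qed.

Let homeo_distxx f : homeo_dist f f = 0.
Proof.
apply/eqP; rewrite eq_le homeo_dist_ge0 andbT; apply: homeo_dist_le => // x.
by rewrite /dst !mdistxx maxxx.
Qed.

Let homeo_dist_positivity f g : homeo_dist f g = 0 -> f = g.
Proof.
move=> fg0.
have e1 : homeo_fun f = homeo_fun g.
  apply/funext => x; apply: mdist_positivity; apply/eqP.
  by rewrite eq_le mdist_ge0 andbT -fg0 (homeo_dist_ge f g x).1.
have e2 : homeo_inv f = homeo_inv g.
  apply/funext => x; apply: mdist_positivity; apply/eqP.
  by rewrite eq_le mdist_ge0 andbT -fg0 (homeo_dist_ge f g x).2.
case: f g e1 e2 {fg0} => [f f' a b c d] [g g' a' b' c' d'] /= e1 e2.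
by subst g g'; congr MkHomeo; exact: Prop_irrelevance.
Qed.

Let homeo_dist_sym f g : homeo_dist f g = homeo_dist g f.
Proof.
rewrite /homeo_dist; congr sup; apply: eq_imagel => x _.
by rewrite (metric_sym (f x)) (metric_sym (homeo_inv f x)).
Qed.

Let homeo_dist_triangle g f h :
  homeo_dist f h <= homeo_dist f g + homeo_dist g h.
Proof.
apply: homeo_dist_le => [|x]; first by rewrite addr_ge0.
have [a1 a2] := homeo_dist_ge f g x; have [b1 b2] := homeo_dist_ge g h x.
rewrite /dst ge_max; apply/andP; split.
  exact: le_trans (metric_triangle _ (g x) _) (lerD a1 b1).
exact: le_trans (metric_triangle _ (homeo_inv g x) _) (lerD a2 b2).
Qed.

HB.instance Definition _ := gen_eqMixin (Homeo cX).
HB.instance Definition _ := gen_choiceMixin (Homeo cX).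
HB.instance Definition _ := isMetric.Build R (Homeo cX)
  homeo_distxx homeo_dist_positivity homeo_dist_sym homeo_dist_triangle.

End HomeoMetric.

Definition Baire_residual (T : topologicalType) (S : set T) : Prop :=
  exists U : nat -> set T,
    (forall i, open (U i) /\ dense (U i)) /\ \bigcap_i U i `<=` S.

Section MetricMeanDimension.
Context {R : realType} {X : metricType R}.
Implicit Type f : X -> X.

Definition dyn_dist f (n : nat) (x y : X) : R :=
  \big[Num.max/0]_(j < n) mdist (iter j f x) (iter j f y).

Definition eps_separated f (n : nat) (eps : R) (A : {fset X}) : Prop :=
  forall x y, x \in A -> y \in A -> x != y -> eps < dyn_dist f n x y.

Local Open Scope ereal_scope.

Definition sep_card f (n : nat) (eps : R) : \bar R :=
  ereal_sup [set (#|` A|%:R)%:E | A in [set A | eps_separated f n eps A]].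

Definition eps_entropy f (eps : R) : \bar R :=
  limn_esup (fun n => (n%:R^-1)%:E * lne (sep_card f n eps)).

Definition upper_mdim f : \bar R :=
  limf_esup (fun eps : R => eps_entropy f eps / (`|ln eps|%R)%:E) 0^'+.

End MetricMeanDimension.

(* Main.v *)
Require Import Defs.
From HB Require Import structures.
From mathcomp Require Import all_boot all_order all_algebra finmap.
From mathcomp Require Import all_classical all_reals all_analysis.
From mathcomp Require Import ring lra.

Set Implicit Arguments.
Unset Strict Implicit.
Unset Printing Implicit Defensive.

Import Order.TTheory GRing.Theory Num.Theory.
Import numFieldNormedType.Exports.

Local Open Scope classical_set_scope.
Local Open Scope ring_scope.

(** Upper bound, for every [f]. In bi-Lipschitz charts the manifold is divided into
    at most [C * eps ^- n] cells of diameter at most [eps], and orbit segments that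
    are separated at scale [eps] have different itineraries through the cells. So
    the entropy at scale [eps] is at most [ln C + n * |ln eps|] ([upper_mdim_le]).

    Lower bound, for generic [f]. Consider the set of all homeomorphisms whose
    entropy is at least [(n - 1 / k) * |ln eps|] at some scale [eps < 1 / k]. It is
    enough that its interior is dense for each [k], since then the intersection of
    these interiors is the required residual set. So every homeomorphism [g] must
    have arbitrarily small perturbations with this property, and the property must
    survive all further small perturbations.

    Persistence comes from horseshoes with a single expanding direction. Let small
    boxes be given in which one coordinate, the height, is distinguished, and
    suppose that the image of each box is confined to a thin neighbourhood of a
    curve passing through all boxes, with the bottom face sent below and the top
    face sent above all of them. By the intermediate value theorem, the image of a
    path that crosses one box crosses every box, so every itinerary is realised
    ([horseshoe_entropy]). The assumption says that some compact sets are mapped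
    into some open sets, hence it is stable under uniform perturbations
    ([maps_across_robust], [maps_across_entropy]). If the curve passes through a
    grid of [M ^ n] points with spacing comparable to [1 / M] ([grid_curve]), the
    entropy is at least [n * ln M] at a scale comparable to [1 / M], which is as
    large as required when [M] is large ([fine_scale]).

    To create such a horseshoe near [g], close up an orbit: a recurrent orbit of
    [g] gives disjoint small cubes, cyclically ordered, with a marked point in each
    that [g] sends into the next cube ([cycle_of_cubes]). In each cube take a curve
    through a fine grid near the marked point, and let the boxes be thin tubes
    around pieces of the curve. Since [g] is only a homeomorphism, the image of a
    tube may be a wild set, and it is not straightened. Instead [g] is composed with
    two homeomorphisms supported in the cubes. The first moves the images of the
    finitely many end points of the tubes to the correct sides of the next cube
    ([move_points], for which [1 < n] is needed); then it also moves the images of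
    the end faces correctly, if the tubes are thin enough. The second keeps all
    heights and squeezes the inner cube onto a thin neighbourhood of the curve
    ([squeeze_onto_curve]). The crossing argument uses only the two sides
    and the confinement, so the wildness in between is harmless
    ([perturb_to_horseshoe]). *)

(** * Homeomorphisms with prescribed support *)

(** Homeomorphisms are carried around with their inverse, because the metric
    on the group of homeomorphisms compares inverses too. *)
Definition supp_homeo (T : topologicalType) (V : set T) (h h' : T -> T) :=
  [/\ continuous h, continuous h', cancel h h', cancel h' h &
      forall x, ~ V x -> h x = x].

Section SuppHomeo.
Context {T : topologicalType}.
Implicit Types (V W : set T) (h : T -> T).

Lemma supp_homeo_id V : supp_homeo V id id.
Proof. by split => // x; exact: cvg_id. Qed.

Lemma supp_homeo_sub V W h h' : V `<=` W ->
  supp_homeo V h h' -> supp_homeo W h h'.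
Proof. by move=> VW [? ? ? ? hV]; split=> // x Wx; apply: hV => /VW. Qed.

Lemma supp_homeo_sym V h h' : supp_homeo V h h' -> supp_homeo V h' h.
Proof.
by move=> [ch ch' hK h'K hV]; split=> // x Vx; rewrite -{1}(hV _ Vx) hK.
Qed.

Lemma supp_homeo_comp V h1 h1' h2 h2' : supp_homeo V h1 h1' ->
  supp_homeo V h2 h2' -> supp_homeo V (h2 \o h1) (h1' \o h2').
Proof.
move=> [c1 c1' K1 K1' V1] [c2 c2' K2 K2' V2]; split.
- by move=> x; apply: continuous_comp; [exact: c1|exact: c2].
- by move=> x; apply: continuous_comp; [exact: c2'|exact: c1'].
- by move=> x /=; rewrite K2 K1.
- by move=> x /=; rewrite K1' K2'.
- by move=> x Vx /=; rewrite V1// V2.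
Qed.

Lemma supp_homeo_iter V h h' k : supp_homeo V h h' ->
  supp_homeo V (iter k h) (iter k h').
Proof.
move=> hV; elim: k => [|k IHk]; first exact: supp_homeo_id.
have := supp_homeo_comp IHk hV; congr supp_homeo.
by apply/funext => x /=; rewrite -iterSr.
Qed.

Lemma supp_homeo_inj V h h' : supp_homeo V h h' -> injective h.
Proof. by move=> [_ _ hK _ _]; exact: can_inj hK. Qed.

Lemma supp_homeo_stable V h h' x : supp_homeo V h h' -> V x -> V (h x).
Proof.
move=> [_ _ hK _ hV] Vx; apply: contrapT => nVhx.
have := hV _ nVhx; move/(can_inj hK) => hxx; apply: nVhx.
by rewrite hxx.
Qed.

(** Composing the whole family works, because on the support of one member all
    the others are the identity. *)
Lemma supp_homeo_glue (I : finType) (B : I -> set T) (h h' : I -> T -> T) :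
  (forall i j x, B i x -> B j x -> i = j) ->
  (forall i, supp_homeo (B i) (h i) (h' i)) ->
  exists k k', supp_homeo (\bigcup_i B i) k k' /\
    forall i x, B i x -> k x = h i x.
Proof.
move=> dB hB.
suff [k [k' [kB kh kV]]] : exists k k', [/\ supp_homeo (\bigcup_i B i) k k',
    forall i x, i \in enum I -> B i x -> k x = h i x &
    forall x, (forall i, i \in enum I -> ~ B i x) -> k x = x].
  by exists k, k'; split=> // i x; apply: kh; rewrite mem_enum.
elim: (enum I) (enum_uniq I) => [_|i s IHs /= /andP[is_ us]].
  by exists id, id; split => //; exact: supp_homeo_id.
have [k [k' [kB kh kV]]] := IHs us.
exists (h i \o k), (k' \o h' i); split.
- apply: supp_homeo_comp => //.
  by apply: supp_homeo_sub (hB i) => x Bx; exists i.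
- move=> j x; rewrite inE => /orP[/eqP -> Bx /=|js Bx /=].
    rewrite kV// => l ls Bl; move: is_; rewrite (dB _ _ _ Bx Bl).
    by rewrite ls.
  rewrite (kh j)//; have [_ _ _ _ -> //] := hB i.
  move=> Bi; have ij := dB _ _ _ Bi (supp_homeo_stable (hB j) Bx).
  by move: is_; rewrite ij js.
- move=> x sx /=; rewrite kV => [|j js]; last first.
    by apply: sx; rewrite inE js orbT.
  by have [_ _ _ _ -> //] := hB i; apply: sx; rewrite inE eqxx.
Qed.

End SuppHomeo.

Lemma lipschitz_cts (R : realType) (V W : normedModType R) (f : V -> W) (K : R) :
  (forall x y, `|f x - f y| <= K * `|x - y|) -> continuous f.
Proof.
move=> fK x; apply/cvgrPdist_lt => e e0; apply/nbhs_ballP.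
exists (e / (1 + `|K|)); first by rewrite /= divr_gt0// ltr_wpDr.
move=> y; rewrite -ball_normE /= ltr_pdivlMr ?ltr_wpDr// => xy.
apply: le_lt_trans (fK _ _) _; apply: le_lt_trans xy.
by rewrite mulrC ler_wpM2l// (le_trans (ler_norm _))// lerDr.
Qed.

(** The equation [x + u x = y] says that [x] is a fixed point of the contraction
    [x |-> y - u x]. All homeomorphisms of the coordinate space constructed below
    are composed of maps of this form. *)
Lemma supp_homeo_lipschitz (R : realType) (E : completeNormedModType R)
    (V : set E) (u : E -> E) (q : R) : 0 <= q < 1 ->
  (forall x y, `|u x - u y| <= q * `|x - y|) ->
  (forall x, ~ V x -> u x = 0) ->
  exists h', supp_homeo V (fun x => x + u x) h'.
Proof.
move=> /andP[q0 q1] uq uV.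
have ex y : exists x, x + u x = y.
  pose g : {fun [set: E] >-> [set: E]} := [fun of totalfun (fun x => y - u x)].
  have ctr : is_contraction g.
    exists (NngNum q0); split=> //= -[a b] _ /=.
    by rewrite opprB addrC addrA subrK distrC uq.
  have [x _ xE] := banach_fixed_point ctr closedT (ex_intro _ 0 I).
  by exists x; rewrite [X in X + _]xE/= subrK.
pose h' y := sval (cid (ex y)).
have h'K y : h' y + u (h' y) = y by rewrite /h'; case: cid.
have lo x y : (1 - q) * `|x - y| <= `|(x + u x) - (y + u y)|.
  rewrite opprD addrACA mulrBl mul1r lerBlDr.
  have := ler_normB (x - y + (u x - u y)) (u x - u y).
  rewrite addrK => /le_trans; apply; rewrite lerD2l; exact: uq.
have q1' : 0 < 1 - q by rewrite subr_gt0.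
have hI x y : x + u x = y + u y -> x = y.
  move=> xy; have := lo x y; rewrite xy subrr normr0 pmulr_rle0//.
  by rewrite normr_le0 subr_eq0 => /eqP.
exists h'; split.
- apply: (@lipschitz_cts _ _ _ _ (1 + q)) => x y.
  by rewrite opprD addrACA (le_trans (ler_normD _ _))// mulrDl mul1r lerD2l.
- apply: (@lipschitz_cts _ _ _ _ (1 - q)^-1) => x y.
  by rewrite -(ler_pM2l q1') mulVKf ?gt_eqF// (le_trans (lo _ _))// !h'K.
- by move=> x; apply: hI; rewrite h'K.
- by move=> x; rewrite h'K.
- by move=> x /uV ->; rewrite addr0.
Qed.

(** * Moving finitely many points *)

Lemma compact_open_margin (R : realType) (T : pseudoMetricType R)
    (K O : set T) : compact K -> open O -> K `<=` O ->
  exists2 e : R, 0 < e & forall x, K x -> ball x e `<=` O.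
Proof.
move=> /compact_near_coveringP cK oO KO.
have : \forall e \near (0:R)^'+, K `<=` [set x | ball x e `<=` O].
  apply: (cK) => x Kx.
  have /nbhs_ballP[e /= e0 xeO] : nbhs x O.
    by apply: open_nbhs_nbhs; split=> //; exact: KO.
  exists (ball x (e / 2), [set d | d < e / 2]) => /=.
    split; first by apply: nbhsx_ballx; rewrite divr_gt0.
    by apply: nbhs_right_lt; rewrite divr_gt0.
  move=> [y d] /= [xy de] z yz; apply: xeO; rewrite [e]splitr.
  by apply: ball_triangle xy _; apply: le_ball yz; exact: ltW.
rewrite /at_right => /nbhs_ballP[e /= e0 H]; exists (e / 2).
  by rewrite divr_gt0.
move=> x Kx; apply: (H (e / 2)) => //=.
  rewrite -ball_normE /= sub0r normrN gtr0_norm ?divr_gt0//.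
  by rewrite ltr_pdivrMr// ltr_pMr// ltr1n.
by rewrite divr_gt0.
Qed.

Section Tent.
Context {R : realType} {E : normedModType R}.
Implicit Types (a x y : E) (e : R).

Definition tent a e x : R := Num.max 0 (1 - `|x - a| / e).

Lemma tent_lipschitz a e x y : 0 < e ->
  `|tent a e x - tent a e y| <= e^-1 * `|x - y|.
Proof.
move=> e0; rewrite /tent; set X := 1 - _; set Y := 1 - _.
have XY : `|X - Y| <= e^-1 * `|x - y|.
  have -> : X - Y = (`|y - a| - `|x - a|) / e by rewrite /X /Y; ring.
  rewrite normrM [X in _ * X]gtr0_norm ?invr_gt0// mulrC ler_pM2l ?invr_gt0//.
  by rewrite (le_trans (ler_dist_dist _ _))// opprB addrA subrK distrC.
apply: le_trans XY; rewrite /Num.max.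
by case: ifP => h1; case: ifP => h2; rewrite ?subrr ?normr0//;
  rewrite ?ler_norml ?ler_normr; apply/andP; split; case: (lerP 0 (X - Y)) => h3;
  rewrite ?(ger0_norm h3) ?(ltr0_norm h3); lra.
Qed.

Lemma tent_ge0 a e x : 0 <= tent a e x.
Proof. by rewrite le_max lexx. Qed.

Lemma tent_le1 a e x : 0 < e -> tent a e x <= 1.
Proof.
by move=> e0; rewrite ge_max ler01 lerBlDr lerDl divr_ge0// ltW.
Qed.

Lemma tent_eq0 a e x : 0 < e -> e <= `|x - a| -> tent a e x = 0.
Proof.
by move=> e0 ex; rewrite /tent max_l// subr_le0 ler_pdivlMr// mul1r.
Qed.

Lemma tent_center a e : tent a e a = 1.
Proof. by rewrite /tent subrr normr0 mul0r subr0 max_r. Qed.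

End Tent.

Section MovePoints.
Context {R : realType} {E : completeNormedModType R}.
Implicit Types (O : set E) (a b v : E).

Lemma move_in_ball O a v e : (forall x, `|x - a| < e -> O x) -> `|v| < e ->
  exists h h', supp_homeo O h h' /\ h a = a + v.
Proof.
move=> aO ve; have e0 : 0 < e by exact: le_lt_trans ve.
have [||x Ox|h' hh'] := @supp_homeo_lipschitz R E O
    (fun x => tent a e x *: v) (`|v| / e).
- by rewrite divr_ge0 ?(ltW e0)//= ltr_pdivrMr// mul1r.
- move=> x y; rewrite -scalerBl normrZ mulrC -mulrA ler_wpM2l//.
  exact: tent_lipschitz.
- by rewrite tent_eq0 ?scale0r// leNgt; apply/negP => /aO.
exists (fun x => x + tent a e x *: v), h'; split => //.
by rewrite tent_center scale1r.
Qed.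

Lemma move_along_segment O a b : open O ->
  (forall t : R, 0 <= t <= 1 -> O (a + t *: (b - a))) ->
  exists h h', supp_homeo O h h' /\ h a = b.
Proof.
move=> oO abO; pose s (t : R) := a + t *: (b - a).
have cs : continuous s.
  by move=> t; apply: cvgD; [exact: cvg_cst|apply: cvgZr_tmp; exact: cvg_id].
have cK : compact (s @` `[0, 1]).
  apply: continuous_compact; last exact: segment_compact.
  exact: continuous_subspaceT.
have [|e e0 eO] := compact_open_margin cK oO.
  by move=> _ [t + <-]; rewrite /= in_itv /=; exact: abO.
have [k ke] : exists k : nat, `|b - a| / k.+1%:R < e.
  have /archi_boundP : 0 <= `|b - a| / e by rewrite divr_ge0 ?(ltW e0).
  set k := Num.bound _ => kP; exists k; rewrite ltr_pdivrMr// -ltr_pdivrMl//.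
  by rewrite mulrC (lt_trans kP)// ltr_nat.
suff H j : (j <= k.+1)%N ->
    exists h h', supp_homeo O h h' /\ h a = s (j%:R / k.+1%:R).
  have [h [h' [hO ha]]] := H k.+1 (leqnn _); exists h, h'; split => //.
  by rewrite ha /s divff ?pnatr_eq0// scale1r addrC subrK.
elim: j => [_|j IHj jk].
  by exists id, id; split; [exact: supp_homeo_id|rewrite /s mul0r scale0r addr0].
have [h [h' [hO ha]]] := IHj (ltnW jk).
have [x|//|g [g' [gO ga]]] := @move_in_ball O (s (j%:R / k.+1%:R))
    (k.+1%:R^-1 *: (b - a)) e.
- move=> xe; apply: (eO (s (j%:R / k.+1%:R))).
    exists (j%:R / k.+1%:R) => //=; rewrite in_itv /= divr_ge0//=.
    by rewrite ler_pdivrMr// mul1r ler_nat ltnW.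
  by rewrite -ball_normE /= distrC.
- by rewrite normrZ gtr0_norm ?invr_gt0// mulrC.
exists (g \o h), (h' \o g'); split; first exact: supp_homeo_comp.
rewrite /= ha ga /s -addrA -scalerDl; congr (_ + _ *: _).
by rewrite -[j.+1%:R]natr1 mulrDl mul1r.
Qed.

End MovePoints.

HB.instance Definition _ (R : realType) m n := Complete.on 'M[R]_(m, n).

Section RowVectors.
Context {R : realType} {n : nat}.
Local Notation E := 'rV[R]_n.
Implicit Types (x y : E).

Lemma coord_le_norm x (i : 'I_n) : `|x ord0 i| <= `|x|.
Proof.
rewrite [leRHS]/Num.Def.normr/= mx_normrE.
exact: (le_bigmax _ (fun j : 'I_1 * 'I_n => `|x j.1 j.2|) (ord0, i)).
Qed.

Lemma norm_le_coord x (M : R) : 0 <= M -> (forall i, `|x ord0 i| <= M) ->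
  `|x| <= M.
Proof.
move=> M0 xM; rewrite [leLHS]/Num.Def.normr/= mx_normrE.
by apply: bigmax_le => // -[j i] _ /=; rewrite ord1.
Qed.

Lemma delta_norm_le (i : 'I_n) : `|delta_mx ord0 i : E| <= 1.
Proof.
apply: norm_le_coord => // j; rewrite mxE eqxx /=.
by case: (j == i); rewrite ?normr1 ?normr0.
Qed.

Lemma coord_dist_le x y (i : 'I_n) : `|x ord0 i - y ord0 i| <= `|x - y|.
Proof. by have := coord_le_norm (x - y) i; rewrite !mxE. Qed.

(** The points of a short segment of [T] in the direction [i0] are seen from [a]
    in distinct directions, since they differ from [a] in the coordinate [i1].
    Hence each point of [P] hides at most one of them. *)
Lemma segment_avoiding (i0 i1 : 'I_n) (a : E) (T : set E) (P : seq E) :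
  i0 != i1 -> open T -> T !=set0 -> a \notin P ->
  exists2 b, T b & forall t : R, a + t *: (b - a) \notin P.
Proof.
move=> i01 oT [b0 Tb0] aP.
have /nbhs_ballP[e /= e0 b0T] : nbhs b0 T by apply: open_nbhs_nbhs.
have e2 : 0 < e / 2 by rewrite divr_gt0.
pose d : R := if b0 ord0 i1 == a ord0 i1 then e / 2 else 0.
have d0 : 0 <= d <= e / 2 by rewrite /d; case: ifP; rewrite ?lexx ltW.
pose b s : E := b0 + d *: delta_mx ord0 i1 + s *: delta_mx ord0 i0.
have bi0 s : b s ord0 i0 = b0 ord0 i0 + s.
  by rewrite !mxE !eqxx (negbTE i01) /= mulr0 addr0 mulr1.
have bi1 s : b s ord0 i1 = b0 ord0 i1 + d.
  by rewrite !mxE !eqxx [_ == i0]eq_sym (negbTE i01) /= mulr0 addr0 mulr1.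
have ba s : b s ord0 i1 != a ord0 i1.
  rewrite bi1 /d; case: (eqVneq (b0 ord0 i1)) => [->|]; last by rewrite addr0.
  by rewrite -subr_eq0 addrAC subrr add0r gt_eqF.
have Tb s : 0 < s < e / 2 -> T (b s).
  move=> /andP[s0 se]; apply: b0T; rewrite -ball_normE /= distrC.
  have -> : b s - b0 = d *: delta_mx ord0 i1 + s *: delta_mx ord0 i0.
    by rewrite /b addrAC [b0 + _]addrC addrK.
  rewrite (le_lt_trans (ler_normD _ _))//.
  rewrite !normrZ (ger0_norm (andP d0).1) (gtr0_norm s0) [ltRHS]splitr.
  apply: ler_ltD.
    by rewrite (le_trans _ (andP d0).2)// ler_piMr ?delta_norm_le ?(andP d0).1.
  by rewrite (le_lt_trans _ se)// ler_piMr ?delta_norm_le ?ltW.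
pose shadow p s := exists t, a + t *: (b s - a) = p.
have shadow1 p s s' : p != a -> shadow p s -> shadow p s' -> s = s'.
  move=> pa [t tp] [t' t'p].
  have tt' : t = t'.
    have := congr1 (fun v : E => v ord0 i1) (etrans tp (esym t'p)).
    rewrite !mxE -!/(b _) => /addrI; rewrite -!/(b _).
    have /= := bi1 s; have /= := bi1 s'; rewrite !mxE => -> -> /mulIf; apply.
    by rewrite subr_eq0 -(bi1 0) ba.
  have t0 : t != 0.
    by apply: contra_neq pa => t0; rewrite -tp t0 scale0r addr0.
  have := congr1 (fun v : E => v ord0 i0) (etrans tp (esym t'p)).
  have /= := bi0 s; have /= := bi0 s'; rewrite !mxE -tt' => -> ->.
  by move=> /addrI /(mulfI t0) /addIr /addrI.
suff [l [r [lr l0 re lrP]]] : exists l r : R, [/\ l < r, 0 <= l, r <= e / 2 &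
    forall s p, l < s < r -> p \in P -> ~ shadow p s].
  exists (b ((l + r) / 2)); first by apply: Tb; lra.
  move=> t; apply/negP => /lrP H; apply: (H ((l + r) / 2)); first lra.
  by exists t.
elim: P aP => [_|p P IHP]; first by exists 0, (e / 2); split.
rewrite inE negb_or eq_sym => /andP[pa /IHP[l [r [lr l0 re lrP]]]].
pose m := (l + r) / 2.
have [[s [lsm ps]]|nps] := pselect (exists s, l < s < m /\ shadow p s).
  exists m, r; split=> //; [by rewrite /m; lra|by rewrite /m; lra|].
  move=> s' q ms'; rewrite inE => /orP[/eqP -> ps'|]; last first.
    by apply: lrP; move: ms'; rewrite /m; lra.
  by have := shadow1 _ _ _ pa ps ps'; lra.
exists l, m; split=> //; [by rewrite /m; lra|by rewrite /m; lra|].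
move=> s q ls; rewrite inE => /orP[/eqP -> ps|]; first by apply: nps; exists s.
by apply: lrP; move: ls; rewrite /m; lra.
Qed.

(** The points are moved one at a time, each along a segment avoiding those that
    have already been placed. It is here that two dimensions are needed. *)
Lemma move_points (i0 i1 : 'I_n) (c : E) (r : R) (I : finType) (a : I -> E)
    (T : I -> set E) : i0 != i1 -> injective a ->
  (forall i, `|a i - c| < r) ->
  (forall i, open (T i)) -> (forall i, T i `&` ball c r !=set0) ->
  exists h h' : E -> E, supp_homeo (ball c r : set E) h h' /\ forall i, T i (h (a i)).
Proof.
move=> i01 inja ac oT T0.
suff [h [h' [hc ha]]] : exists h h' : E -> E, supp_homeo (ball c r : set E) h h' /\
    forall i, i \in enum I -> T i (h (a i)).
  by exists h, h'; split=> // i; apply: ha; rewrite mem_enum.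
elim: (enum I) (enum_uniq I) => [_|k s IHs /= /andP[ks us]].
  by exists id, id; split => //; exact: supp_homeo_id.
have [h [h' [hc ha]]] := IHs us.
have hin i : ball c r (h (a i)).
  by apply: (supp_homeo_stable hc); rewrite -ball_normE /= distrC.
pose P := [seq h (a i) | i <- s].
have kP : h (a k) \notin P.
  apply/negP => /mapP[i is_ /(supp_homeo_inj hc)/inja ki].
  by move: ks; rewrite ki is_.
have [|b [Tb cb] bP] := @segment_avoiding i0 i1 (h (a k)) _ P i01 _ (T0 k) kP.
  by apply: openI => //; exact: ball_open.
have [||g [g' [gO ga]]] := @move_along_segment R E
    ((ball c r : set E) `&` ~` [set` P]) (h (a k)) b.
- apply: openI; first exact: ball_open.
  apply: closed_openC.
  have /accessible_finite_set_closed := @hausdorff_accessible E (@norm_hausdorff _ _).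
  by apply; exact: finite_seq.
- move=> t /andP[t0 t1]; split; last by apply/negP; exact: bP.
  have := hin k; rewrite -!ball_normE /= in cb *; set x := h (a k) => xc.
  have -> : c - (x + t *: (b - x)) = (1 - t) *: (c - x) + t *: (c - b).
    by apply/rowP => i; rewrite !mxE; ring.
  have cxb : t * `|c - b| <= t * r by rewrite ler_wpM2l// ltW.
  rewrite (le_lt_trans (ler_normD _ _))// !normrZ (ger0_norm t0).
  rewrite ger0_norm ?subr_ge0//; case: (eqVneq t 1) => [->|t1'].
    by rewrite subrr mul0r add0r mul1r.
  have : (1 - t) * `|c - x| < (1 - t) * r.
    by rewrite ltr_pM2l// subr_gt0 lt_neqAle t1' t1.
  by move: cxb; lra.
exists (g \o h), (h' \o g'); split.
  by apply: supp_homeo_comp => //; apply: supp_homeo_sub gO => x [].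
move=> i; rewrite inE => /orP[/eqP ->|is_] /=; first by rewrite ga.
have [_ _ _ _ -> //] := gO; first exact: ha.
by move=> [_]; apply; rewrite /= map_f.
Qed.

End RowVectors.

(** * Squeezing a cube onto a curve *)

Section Squeeze.
Context {R : realType} {n : nat}.
Local Notation E := 'rV[R]_n.

(** The curve is a graph over the coordinate [i0]. Moving each point a definite
    proportion of the way to the point of the curve at the same height is a
    homeomorphism if the proportion is small; iterating it brings the inner cube
    as close to the curve as desired, while heights are never changed. *)
Lemma squeeze_onto_curve (i0 : 'I_n) (c : E) (r1 r2 : R) (g : R -> E) (K a b : R)
    (beta : R) : 0 < r1 < r2 -> 0 < beta ->
  (forall s t, `|g s - g t| <= K * `|s - t|) ->
  (forall t, g t ord0 i0 = t) ->
  (forall t, a <= t <= b -> `|g t - c| <= r1) ->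
  exists h h' : E -> E, [/\ supp_homeo (ball c r2 : set E) h h',
    forall x, h x ord0 i0 = x ord0 i0 &
    forall x, `|x - c| <= r1 -> a <= x ord0 i0 <= b ->
      `|h x - g (x ord0 i0)| < beta].
Proof.
move=> /andP[r10 r12] b0 gK gi0 gc; have r20 := lt_trans r10 r12.
pose A (x : E) : E := g (x ord0 i0) - x.
have K0 : 0 <= K by have := le_trans (normr_ge0 _) (gK 1 0); rewrite subr0 normr1 mulr1.
have A_lip x y : `|A x - A y| <= (K + 1) * `|x - y|.
  have -> : A x - A y = (g (x ord0 i0) - g (y ord0 i0)) - (x - y).
    by apply/rowP => i; rewrite !mxE; ring.
  rewrite (le_trans (ler_normB _ _))// mulrDl mul1r lerD2r.
  by rewrite (le_trans (gK _ _))// ler_wpM2l// coord_dist_le.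
pose C : R := `|A c| + (K + 1) * r2; pose L : R := C / r2 + (K + 1).
have C0 : 0 <= C by rewrite addr_ge0// mulr_ge0 ?addr_ge0// ltW.
have L0 : 0 < L by rewrite ltr_wpDl ?divr_ge0 ?(ltW r20)// ltr_wpDl.
have A_bd x : `|x - c| < r2 -> `|A x| <= C.
  move=> xc; rewrite -(subrK (A c) (A x)) addrC (le_trans (ler_normD _ _))//.
  rewrite lerD2l (le_trans (A_lip _ _))// ler_wpM2l ?addr_ge0//; exact: ltW.
pose U (x : E) : E := tent c r2 x *: A x.
have U_lip1 x y : `|x - c| < r2 -> `|U x - U y| <= L * `|x - y|.
  move=> xc; rewrite /U -(subrK (tent c r2 y *: A x) (_ *: A x)) -scalerBl -addrA.
  rewrite -scalerBr (le_trans (ler_normD _ _))// !normrZ mulrDl lerD//.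
    rewrite mulrAC -mulrA mulrC ler_pM// ?A_bd//.
    by rewrite mulrC (le_trans (tent_lipschitz _ _ _ _))// mulrC.
  rewrite ger0_norm ?tent_ge0// -[leRHS]mul1r ler_pM ?tent_ge0 ?tent_le1//.
have U_lip x y : `|U x - U y| <= L * `|x - y|.
  have [xc|xc] := ltP `|x - c| r2; first exact: U_lip1.
  have [yc|yc] := ltP `|y - c| r2.
    by rewrite distrC [in leRHS]distrC; exact: U_lip1.
  rewrite /U !tent_eq0// !scale0r subrr normr0 mulr_ge0//; exact: ltW.
(* The iterated map is [x + q * U x], where [L] is a Lipschitz constant of [U]. *)
pose q : R := (L + 1)^-1.
have q0 : 0 < q by rewrite invr_gt0 addr_gt0.
have q1 : q <= 1 by rewrite invf_le1; lra.
have [||x xc|h' hh'] := @supp_homeo_lipschitz R E (ball c r2)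
    (fun x => q *: U x) (q * L).
- have qL : q * (L + 1) = 1 by rewrite mulVf// gt_eqF// addr_gt0.
  by rewrite mulr_ge0 ?(ltW q0) ?(ltW L0)//=; lra.
- by move=> x y; rewrite -scalerBr normrZ (gtr0_norm q0) -mulrA ler_pM2l.
- rewrite /U tent_eq0 ?scale0r ?scaler0// leNgt; apply/negP => xr.
  by apply: xc; rewrite -ball_normE /= distrC.
set h : E -> E := fun x => _ in hh'.
have hi0 x : h x ord0 i0 = x ord0 i0.
  by rewrite !mxE gi0 subrr !mulr0 addr0.
(* [tau] bounds the tent from below on the inner cube, so there each iteration
   shrinks the distance to the curve by the factor [rho]. *)
pose tau : R := 1 - r1 / r2.
have tau0 : 0 < tau by rewrite subr_gt0 ltr_pdivrMr// mul1r.
pose rho : R := 1 - q * tau.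
have tau1 : tau <= 1 by rewrite lerBlDr lerDl divr_ge0 ?ltW.
have rho0 : 0 <= rho by rewrite subr_ge0 mulr_ile1// ltW.
have rho1 : rho < 1 by rewrite ltrBlDr ltrDl mulr_gt0.
have hE x : h x - g (x ord0 i0) = (1 - q * tent c r2 x) *: (x - g (x ord0 i0)).
  by rewrite /h /U /A; apply/rowP => i; rewrite !mxE; ring.
have tq x : 0 <= q * tent c r2 x <= 1.
  by rewrite mulr_ge0 ?(ltW q0) ?tent_ge0//= mulr_ile1 ?tent_ge0 ?tent_le1// ltW.
have h_in x : `|x - c| <= r1 -> a <= x ord0 i0 <= b -> `|h x - c| <= r1.
  move=> xc xab; have [t /andP[t0 t1] hxE] : exists2 t : R, 0 <= t <= 1 &
      h x - g (x ord0 i0) = (1 - t) *: (x - g (x ord0 i0)).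
    by exists (q * tent c r2 x).
  have -> : h x - c = (1 - t) *: (x - c) + t *: (g (x ord0 i0) - c).
    by rewrite -(subrK (g (x ord0 i0)) (h x)) hxE; apply/rowP => i; rewrite !mxE; ring.
  rewrite (le_trans (ler_normD _ _))// !normrZ (ger0_norm t0) ger0_norm ?subr_ge0//.
  rewrite (_ : r1 = (1 - t) * r1 + t * r1); last by ring.
  by rewrite lerD// ler_wpM2l ?subr_ge0// gc.
have h_near x : `|x - c| <= r1 ->
    `|h x - g (x ord0 i0)| <= rho * `|x - g (x ord0 i0)|.
  move=> xc; rewrite hE normrZ ler_wpM2r// ger0_norm; last by have := tq x; lra.
  rewrite /rho lerD2l lerN2 ler_pM2l// /tent le_max; apply/orP; right.
  by rewrite lerD2l lerN2 ler_pM2r ?invr_gt0.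
have [k kP] : exists k, rho ^+ k * (r1 + r1) < beta.
  have /cvg_expr : `|rho| < 1 by rewrite ger0_norm.
  move=> /cvgrPdist_lt /(_ (beta / (r1 + r1))) [|k _ /(_ k (leqnn k))].
    by rewrite divr_gt0// addr_gt0.
  rewrite /= sub0r normrN ger0_norm ?exprn_ge0// => kb; exists k.
  by rewrite -ltr_pdivlMr// addr_gt0.
exists (iter k h), (iter k h'); split.
- exact: supp_homeo_iter.
- by move=> x; elim: k {kP} => //= k IHk; rewrite hi0.
move=> x xc xab; apply: le_lt_trans kP.
suff [_ _ ?] : [/\ `|iter k h x - c| <= r1, iter k h x ord0 i0 = x ord0 i0 &
    `|iter k h x - g (x ord0 i0)| <= rho ^+ k * (r1 + r1)] by [].
elim: k => [|k [IH1 IH2 IH3]] /=.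
  split=> //; rewrite expr0 mul1r.
  have -> : x - g (x ord0 i0) = (x - c) + (c - g (x ord0 i0)) by rewrite addrA subrK.
  by rewrite (le_trans (ler_normD _ _))// lerD// distrC gc.
split; [by apply: h_in; rewrite ?IH2|by rewrite hi0|].
rewrite -IH2 (le_trans (h_near _ IH1))// exprS -mulrA ler_wpM2l//.
by rewrite IH2.
Qed.

End Squeeze.

(** * A curve through a fine grid *)

Section GridCurve.
Context {R : realType} {n : nat}.
Local Notation E := 'rV[R]_n.

Let coord_natB (m : nat) (a b : 'I_m) : a != b ->
  1 <= `|(a : nat)%:R - (b : nat)%:R : R|.
Proof.
have H (x y : nat) : (x < y)%N -> 1 <= `|x%:R - y%:R : R|.
  move=> xy; rewrite distrC ger0_norm ?subr_ge0 ?ler_nat 1?ltnW//.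
  by rewrite -natrB ?ler1n ?subn_gt0// ltnW.
rewrite neq_ltn => /orP[/H//|/H]; by rewrite distrC.
Qed.

(** The grid has as many points as cells of side [r / m.+1] fill the cube of side
    [r], and the curve visits all of them. The height at which it does so is the
    coordinate [i0] of the point, increased by a fraction of the cell that depends
    on the rank of the point in an enumeration; so distinct points are visited at
    distinct heights. Two points of the grid differ either in some other
    coordinate, hence by a full cell, or in the coordinate [i0], and then the
    fractions are too small to bring them together. *)
Lemma grid_curve (i0 : 'I_n) (e : E) (r : R) (m : nat) : 0 < r ->
  exists (g : R -> E) (K : R) (p q : {ffun 'I_n -> 'I_m.+1} -> R),
  [/\ forall s t, `|g s - g t| <= K * `|s - t|,
      forall t, g t ord0 i0 = t,
      forall t, `|t - e ord0 i0| <= r / 2 -> `|g t - e| <= r / 2,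
      forall w, e ord0 i0 - r / 2 < p w < q w /\ q w < e ord0 i0 + r / 2 &
      forall w w' t t', w != w' -> p w <= t <= q w -> p w' <= t' <= q w' ->
        r / (2 * m.+1%:R) <= `|g t - g t'|].
Proof.
move=> r0; pose I : finType := {ffun 'I_n -> 'I_m.+1}.
have I0 : 0 < #|I|%:R :> R by rewrite ltr0n card_ffun card_ord expn_gt0.
pose M : R := m.+1%:R; have M0 : 0 < M by rewrite ltr0n.
pose s : R := r / M; have s0 : 0 < s by rewrite divr_gt0.
(* The fraction, in [0, 1 / 2), separating the points of one layer of cells. *)
pose d (w : I) : R := (enum_rank w)%:R / (2 * #|I|%:R).
have d_ge0 w : 0 <= d w by rewrite divr_ge0// mulr_ge0.
pose gam0 : R := (2 * #|I|%:R)^-1.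
have gam00 : 0 < gam0 by rewrite invr_gt0 mulr_gt0.
have d_le w : d w + gam0 <= 1 / 2.
  rewrite /d /gam0 -[X in _ + X]mul1r -mulrDl natr1 ler_pdivrMr ?mulr_gt0//.
  by rewrite mulrA divrK ?unitfE// mul1r ler_nat.
have dB w w' : w != w' -> gam0 <= `|d w - d w'|.
  move=> ww'; rewrite /d -mulrBl normrM [X in _ * X]gtr0_norm//.
  apply: ler_peMl; first exact: ltW.
  by apply: coord_natB; rewrite (inj_eq enum_rank_inj).
have gam0_le : gam0 <= 1 / 2.
  have [w _] : exists w : I, true by exists [ffun=> ord0].
  by have := d_le w; have := d_ge0 w; lra.
pose gam := s * gam0; have gam_gt0 : 0 < gam by rewrite mulr_gt0.
pose tm (w : I) : R := e ord0 i0 - r / 2 + s * ((w i0 : nat)%:R + 1 / 4 + d w).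
have rE : r = s * M by rewrite /s divfK ?gt_eqF.
have wM (w : I) i : 0 <= ((w i : nat)%:R : R) <= M - 1.
  by rewrite ler0n /= /M -natr1 addrK ler_nat -ltnS ltn_ord.
have tm_far (w w' : I) : w i0 != w' i0 -> s * (1 / 2 + gam0) <= `|tm w - tm w'|.
  move=> /coord_natB ww; rewrite /tm opprD addrACA subrr add0r -mulrBr.
  rewrite normrM gtr0_norm// ler_pM2l//.
  move: ww; have := d_ge0 w; have := d_le w; have := d_ge0 w'; have := d_le w'.
  rewrite !ler_normr => *; lra.
have tmB w w' : w != w' -> gam <= `|tm w - tm w'|.
  move=> ww'; have [wE|/tm_far] := eqVneq (w i0) (w' i0); last first.
    by apply: le_trans; rewrite ler_pM2l//; lra.
  rewrite /tm wE opprD addrACA subrr add0r -mulrBr normrM gtr0_norm// ler_pM2l//.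
  by rewrite opprD addrACA subrr add0r dB.
have tm_lo w : e ord0 i0 - r / 2 < tm w.
  rewrite ltrDl mulr_gt0//; have := d_ge0 w; have := wM w i0; lra.
have tm_hi w : tm w + gam < e ord0 i0 + r / 2.
  rewrite /tm /gam -addrA -mulrDr.
  have : s * ((w i0 : nat)%:R + 1 / 4 + d w + gam0) < s * M.
    by rewrite ltr_pM2l//; have := d_le w; have := wM w i0; lra.
  rewrite -rE; lra.
(* Equal to 1 within [gam / 4] of [tm w], with disjoint supports. *)
pose bump w t : R := Num.min 1 (2 * tent (tm w) (gam / 2) t).
have g2 : 0 < gam / 2 by rewrite divr_gt0.
have bump01 w t : 0 <= bump w t <= 1.
  by rewrite /bump le_min ler01 mulr_ge0 ?tent_ge0//= ge_min lexx.
have bump0 w t : bump w t != 0 -> `|t - tm w| < gam / 2.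
  apply: contraNT; rewrite -leNgt => tw.
  by rewrite /bump tent_eq0// mulr0 min_r.
have bump1 w t : `|t - tm w| <= gam / 4 -> bump w t = 1.
  move=> tw; apply/min_l; rewrite -ler_pdivrMl// mulr1 le_max; apply/orP; right.
  rewrite lerBrDr -lerBrDl (_ : 1 - _ = 1 / 2); last by lra.
  rewrite ler_pdivrMr//; lra.
have bump_uniq w w' t : bump w t != 0 -> bump w' t != 0 -> w = w'.
  move=> /bump0 wt /bump0 w't; apply: contrapT => /eqP /tmB.
  have := ler_normB (t - tm w') (t - tm w).
  rewrite opprB addrC addrA subrK; lra.
have bump_lip w t t' : `|bump w t - bump w t'| <= 4 / gam * `|t - t'|.
  have := tent_lipschitz (tm w) t t' g2; rewrite /bump.
  set x := tent _ _ t; set y := tent _ _ t'; set D := `|t - t'|.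
  rewrite invf_div => xy; apply: (@le_trans _ _ (2 * `|x - y|)); last by lra.
  rewrite ler_norml /Num.min; case: ifP => h1; case: ifP => h2;
    case: (lerP 0 (x - y)) => h3; rewrite ?(ger0_norm h3) ?(ltr0_norm h3);
    apply/andP; split; lra.
pose y (w : I) i : R := s * ((w i : nat)%:R + 1 / 2) - r / 2.
have y_le w i : `|y w i| <= r / 2.
  have : 0 <= s * ((w i : nat)%:R + 1 / 2) <= s * M.
    by rewrite ler_pM2l// mulr_ge0 ?(ltW s0)//; have := wM w i; lra.
  by rewrite -rE /y ler_norml; lra.
pose f i t : R := \sum_w bump w t * y w i.
have f_bump w i t : bump w t != 0 -> f i t = bump w t * y w i.
  move=> wt; rewrite /f (bigD1 w)//= big1 ?addr0// => w' w'w.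
  by have [->|/(bump_uniq _ _ _ wt) ww'] := eqVneq (bump w' t) 0;
    rewrite ?mul0r// ww' eqxx in w'w *.
have f_le i t : `|f i t| <= r / 2.
  have [[w wt]|nw] := pselect (exists w, bump w t != 0).
    rewrite (f_bump w)// normrM -[leRHS]mul1r ler_pM//.
    by have /andP[? ?] := bump01 w t; rewrite ger0_norm.
  rewrite /f big1 ?normr0 ?divr_ge0 ?ltW// => w _.
  have [->|wt] := eqVneq (bump w t) 0; first by rewrite mul0r.
  by exfalso; apply: nw; exists w.
have f_lip i t t' : `|f i t - f i t'| <= (#|I|%:R * (4 / gam * (r / 2))) * `|t - t'|.
  rewrite /f -sumrB (le_trans (ler_norm_sum _ _ _))//.
  rewrite -mulrA mulr_natl -sumr_const ler_sum// => w _.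
  rewrite -mulrBl normrM mulrAC ler_pM//; exact: bump_lip.
pose g t : E := \row_i (if i == i0 then t else e ord0 i + f i t).
exists g, (#|I|%:R * (4 / gam * (r / 2)) + 1), tm, (fun w => tm w + gam / 4).
split.
- move=> t t'; have K0 : 0 <= #|I|%:R * (4 / gam * (r / 2)).
    by rewrite !mulr_ge0// ?invr_ge0 ltW.
  apply: norm_le_coord => [|i]; first by rewrite mulr_ge0// addr_ge0.
  rewrite !mxE; case: eqP => _; last first.
    by rewrite opprD addrACA subrr add0r (le_trans (f_lip _ _ _))// ler_wpM2r// lerDl.
  by rewrite ler_peMl// lerDr.
- by move=> t; rewrite mxE eqxx.
- move=> t te; apply: norm_le_coord => [|i]; first by rewrite divr_ge0// ltW.
  rewrite !mxE; case: eqP => [-> //|_].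
  by rewrite addrAC subrr add0r.
- by move=> w; have := tm_lo w; have := tm_hi w; split; lra.
- move=> w w' t t' ww' wt w't'; rewrite -/M.
  have sE : r / (2 * M) = s / 2 by rewrite /s invfM; ring.
  have [wE|] := pselect (forall i, i != i0 -> w i = w' i).
    have : w i0 != w' i0.
      apply: contra_neq ww' => ww0; apply/ffunP => i.
      by have [->|/wE] := eqVneq i i0.
    move=> /tm_far tt; apply: le_trans (coord_dist_le _ _ i0).
    rewrite !mxE eqxx sE; move: tt; rewrite mulrDr -/gam.
    by rewrite !ler_normr; lra.
  move=> /existsNP[i /not_implyP[ii0 /eqP wi]].
  apply: le_trans (coord_dist_le _ _ i); rewrite !mxE (negbTE ii0).
  have b1 : bump w t = 1 by apply: bump1; rewrite ler_norml; lra.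
  have b1' : bump w' t' = 1 by apply: bump1; rewrite ler_norml; lra.
  rewrite (f_bump w) ?b1 ?oner_eq0// (f_bump w') ?b1' ?oner_eq0// !mul1r.
  have -> : e ord0 i + y w i - (e ord0 i + y w' i) =
      s * ((w i : nat)%:R - (w' i : nat)%:R) by rewrite /y; ring.
  rewrite normrM gtr0_norm// sE ler_pM2l//.
  by have := coord_natB wi; lra.
Qed.

End GridCurve.

(** * Crossing paths and horseshoes *)

Section Crossing.
Context {R : realType}.
Implicit Types (u : R -> R) (a b p q : R).

Lemma first_hit u a b q : a <= b ->
  (forall x, a <= x <= b -> {for x, continuous u}) -> u a <= q <= u b ->
  exists t, [/\ a <= t <= b, u t = q & forall x, a <= x <= t -> u x <= q].
Proof.
move=> ab cu /andP[uaq qub].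
pose A := [set x | a <= x <= b /\ q <= u x].
have Ab : A b by split; rewrite ?ab ?lexx.
have hA : has_inf A by split; [exists b|exists a => x [/andP[]]].
pose t := inf A.
have tb : t <= b by apply: ge_inf => //; exact: hA.2.
have at_ : a <= t by apply: lb_le_inf; [exists b|move=> x [/andP[]]].
have before x : a <= x -> x < t -> u x < q.
  move=> ax xt; rewrite ltNge; apply/negP => qx.
  have : t <= x by apply: ge_inf; [exact: hA.2|split; lra].
  by lra.
have ct : {for t, continuous u} by apply: cu; rewrite at_.
have utq : u t = q.
  apply/eqP; rewrite eq_le; apply/andP; split; rewrite leNgt; apply/negP => uq.
    have ta : a < t.
      by rewrite lt_neqAle at_ andbT; apply/negP => /eqP ta; move: uaq; rewrite ta; lra.
    have /cvgrPdist_lt/(_ (u t - q))[|d /= d0 ud] := ct; first by lra.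
    pose x := Num.max a (t - d / 2).
    have xt : x < t by rewrite gt_max ta; lra.
    have ax : a <= x by rewrite le_max lexx.
    have dx : t - d / 2 <= x by rewrite le_max lexx orbT.
    have := before _ ax xt; have := ud x; rewrite /ball_ /=.
    rewrite ger0_norm; last lra.
    by move=> /(_ ltac:(lra)); rewrite ltr_norml; lra.
  have /cvgrPdist_lt/(_ (q - u t))[|d /= d0 ud] := ct; first by lra.
  have [x [xab qx] xtd] := inf_adherent d0 hA.
  have tx : t <= x by apply: ge_inf => //; exact: hA.2.
  have := ud x; rewrite /ball_ /= ler0_norm; last lra.
  by move=> /(_ ltac:(rewrite -/t in xtd; lra)); rewrite ltr_norml; lra.
exists t; split => //; first by rewrite at_.
move=> x /andP[ax]; rewrite le_eqVlt => /orP[/eqP ->|xt]; first by rewrite utq.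
by apply: ltW; exact: before.
Qed.

(** Cut at the first passage through [q], then at the last earlier passage
    through [p]. *)
Lemma crossing u a b p q : a <= b ->
  (forall x, a <= x <= b -> {for x, continuous u}) ->
  u a <= p -> p <= q -> q <= u b ->
  exists s t, [/\ a <= s, s <= t, t <= b, u s = p /\ u t = q &
    forall x, s <= x <= t -> p <= u x <= q].
Proof.
move=> ab cu uap pq qub.
have [|t [/andP[at_ tb] utq uq]] := first_hit ab cu (q := q); first by lra.
have [||| s [/andP[ts sa] us up]] := @first_hit (fun x => - u (- x)) (- t) (- a) (- p).
- by lra.
- move=> x xta; apply: continuousN; apply: continuous_comp.
    exact: oppr_continuous.
  by apply: cu; lra.
- by rewrite !opprK; lra.
exists (- s), t; split; [lra|lra|lra|by split=> //; lra|].
move=> x xst; rewrite uq; last by lra.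
by have := up (- x); rewrite opprK; lra.
Qed.

End Crossing.

(** The predicate [P l g a b] stands for: the path [g], restricted to [a, b],
    crosses all the boxes [Q l i]. The parts of the path with a prescribed
    itinerary form a decreasing sequence of intervals. *)
Lemma horseshoe_itinerary (R : realType) (X T I : Type) (sigma : T -> T)
    (f : X -> X) (Q : T -> I -> set X) (P : T -> (R -> X) -> R -> R -> Prop) :
  (forall l g a b i, a <= b -> P l g a b -> exists s t,
    [/\ a <= s, s <= t, t <= b, P (sigma l) (f \o g) s t &
        forall x, s <= x <= t -> Q l i (g x)]) ->
  forall l g a b (w : seq I), a <= b -> P l g a b ->
  exists2 x, a <= x <= b & forall i k, (k < size w)%N ->
    Q (iter k sigma l) (nth i w k) (iter k f (g x)).
Proof.
move=> H l g a b w; elim: w l g a b => [|i w IHw] l g a b ab Pl.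
  by exists a; rewrite ?lexx.
have [s [t [as_ st tb Pst Qst]]] := H l g a b i ab Pl.
have [x xst xQ] := IHw _ _ _ _ st Pst.
exists x; first by lra.
by move=> i' [|k] /= kw; [exact: Qst|rewrite -!iterS !iterSr; exact: xQ].
Qed.

Section HorseshoeEntropy.
Context {R : realType} {X : metricType R}.

Lemma limn_esup_ge (u : nat -> \bar R) (c : \bar R) :
  (forall m, (0 < m)%N -> (c <= u m)%E) -> (c <= limn_esup u)%E.
Proof.
move=> cu; rewrite /limn_esup limf_esupE; apply: le_ereal_inf_tmp => _ [V [N _ NV] <-].
apply: le_trans (cu N.+1 isT) _; apply: ereal_sup_ubound.
by exists N.+1 => //; apply: NV => /=.
Qed.

Lemma limn_esup_le (u : nat -> \bar R) (c : \bar R) :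
  (forall m, (0 < m)%N -> (u m <= c)%E) -> (limn_esup u <= c)%E.
Proof.
move=> cu; rewrite /limn_esup limf_esupE; apply: ereal_inf_le.
exists (ereal_sup (u @` [set k | (0 < k)%N])).
  by exists [set k | (0 < k)%N] => //; exists 1%N.
by apply: ge_ereal_sup => _ [k /= k0 <-]; exact: cu.
Qed.

(** There is one orbit for each itinerary, and different itineraries make the
    orbits visit different boxes at some time. *)
Lemma horseshoe_entropy (T : Type) (I : finType) (sigma : T -> T) (f : X -> X)
    (Q : T -> I -> set X) (P : T -> (R -> X) -> R -> R -> Prop) (eps : R)
    l g (a b : R) : 0 < eps -> a <= b -> P l g a b -> (0 < #|I|)%N ->
  (forall l g a b i, a <= b -> P l g a b -> exists s t,
    [/\ a <= s, s <= t, t <= b, P (sigma l) (f \o g) s t &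
        forall x, s <= x <= t -> Q l i (g x)]) ->
  (forall l i j x y, i != j -> Q l i x -> Q l j y -> eps < mdist x y) ->
  ((ln #|I|%:R)%:E <= eps_entropy f eps)%E.
Proof.
move=> eps0 ab Pl I0 HP sepQ.
have [i0 _] : exists i : I, true by case/card_gt0P: I0 => i _; exists i.
apply: limn_esup_ge => m m0.
have /choice[x xQ] : forall w : m.-tuple I, exists x : X, forall k, (k < m)%N ->
    Q (iter k sigma l) (nth i0 w k) (iter k f x).
  move=> w; have [t _ tQ] := horseshoe_itinerary HP w ab Pl.
  by exists (g t) => k km; apply: tQ; rewrite size_tuple.
have far (w w' : m.-tuple I) : w != w' -> eps < dyn_dist f m (x w) (x w').
  move=> ww'; have [k kw] : exists k : 'I_m, nth i0 w k != nth i0 w' k.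
    apply: contrapT => /forallNP nk; move/negP: ww'; apply; apply/eqP/val_inj.
    apply: (@eq_from_nth _ i0); rewrite ?size_tuple// => k km.
    by apply/eqP/negPn/negP; exact: (nk (Ordinal km)).
  apply: lt_le_trans (sepQ _ _ _ _ _ kw (xQ w k (ltn_ord k)) (xQ w' k (ltn_ord k))) _.
  exact: (le_bigmax _ (fun j : 'I_m => mdist (iter j f (x w)) (iter j f (x w')))).
have xI : injective x.
  move=> w w' ww'; apply: contrapT => /eqP /far; rewrite ww'.
  apply/negP; rewrite -leNgt (le_trans _ (ltW eps0))//.
  by apply: bigmax_le => // j _; rewrite mdistxx.
pose A : {fset X} := [fset x w | w : m.-tuple I in predT]%fset.
have cA : #|` A| = (#|I| ^ m)%N.
  by rewrite card_imfset //= -cardE card_tuple.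
have sepA : eps_separated f m eps A.
  move=> _ _ /imfsetP[w _ ->] /imfsetP[w' _ ->] ww'.
  by apply: far; apply: contra_neq ww' => ->.
have I0' : 0 < #|I|%:R :> R by rewrite ltr0n.
apply: (@le_trans _ _ ((m%:R^-1)%:E * lne (#|I|%:R ^+ m)%:E)%E).
  rewrite lne_EFin ?exprn_gt0// lnXn// -EFinM lee_fin -[ln _ *+ m]mulr_natl.
  by rewrite mulrA mulVf ?mul1r// pnatr_eq0 -lt0n.
apply: lee_wpmul2l; first by rewrite lee_fin.
have cs : ((#|I|%:R ^+ m)%:E <= sep_card f m eps)%E.
  by apply: ereal_sup_ubound; exists A => //; rewrite cA natrX.
have pos : (0 <= (#|I|%:R ^+ m : R)%:E)%E by rewrite lee_fin exprn_ge0// ltW.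
rewrite lee_lne// in_itv /= ?leey ?pos// andbT.
exact: le_trans cs.
Qed.

End HorseshoeEntropy.

(** * The upper bound *)

Section UpperBound.
Context {R : realType} {X : metricType R}.
Implicit Type f : X -> X.

(** An orbit segment is recorded by the codes of its points, and separated orbit
    segments have different records. *)
Lemma eps_entropy_le f (Z : finType) (code : X -> Z) (eps : R) :
  0 <= eps -> (0 < #|Z|)%N ->
  (forall x y, code x = code y -> mdist x y <= eps) ->
  (eps_entropy f eps <= (ln #|Z|%:R)%:E)%E.
Proof.
move=> eps0 Z0 codeP; apply: limn_esup_le => m m0.
have Z0' : 0 < #|Z|%:R :> R by rewrite ltr0n.
have sc : (sep_card f m eps <= (#|Z|%:R ^+ m)%:E)%E.
  apply: ge_ereal_sup => _ [A sepA <-]; rewrite lee_fin -natrX ler_nat.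
  pose c (x : X) : {ffun 'I_m -> Z} := [ffun k : 'I_m => code (iter k f x)].
  have cI : {in A &, injective c}.
    move=> x y xA yA cxy; apply: contrapT => /eqP /(sepA _ _ xA yA).
    apply/negP; rewrite -leNgt; apply: bigmax_le => // j _.
    apply: codeP; have := congr1 (fun h : {ffun _ -> _} => h j) cxy.
    by rewrite !ffunE.
  have u : uniq (map c (enum_fset A)) by rewrite (@map_inj_in_uniq _ _ c (enum_fset A) cI) fset_uniq.
  rewrite -(size_map c) -(card_uniqP u).
  by rewrite (leq_trans (max_card _))// card_ffun card_ord.
apply: (@le_trans _ _ ((m%:R^-1)%:E * lne (#|Z|%:R ^+ m)%:E)%E); last first.
  rewrite lne_EFin ?exprn_gt0// lnXn// -EFinM lee_fin -[ln _ *+ m]mulr_natl.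
  by rewrite mulrA mulVf ?mul1r// pnatr_eq0 -lt0n.
apply: lee_wpmul2l; first by rewrite lee_fin.
rewrite lee_lne// in_itv /= leey andbT; last by rewrite lee_fin exprn_ge0// ltW.
by apply: ereal_sup_ubound => /=; exists fset0.
Qed.

End UpperBound.

Section GridCode.
Context {R : realType} {n : nat}.
Local Notation E := 'rV[R]_n.

Lemma grid_code (B eta : R) : 0 <= B -> 0 < eta ->
  exists (q : nat) (code : E -> {ffun 'I_n -> 'I_q.+1}),
    q.+1%:R <= 2 * B / eta + 1 /\
    forall x y, `|x| <= B -> `|y| <= B -> code x = code y -> `|x - y| <= eta.
Proof.
move=> B0 eta0; pose z (x : E) i := (x ord0 i + B) / eta.
pose q := Num.truncn (2 * B / eta).
exists q, (fun x => [ffun i => inord (Num.truncn (z x i))]); split.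
  rewrite -natr1 lerD2r; have /truncn_itv/andP[] // : 0 <= 2 * B / eta.
  by rewrite divr_ge0// ?mulr_ge0// ltW.
have zP x i : `|x| <= B -> 0 <= z x i <= 2 * B / eta.
  move=> xB; have := le_trans (coord_le_norm x i) xB; rewrite ler_norml => xi.
  by rewrite /z divr_ge0 ?(ltW eta0)//= ?ler_pM2r ?invr_gt0//; lra.
move=> x y xB yB /ffunP xy; apply: norm_le_coord => [|i]; first exact: ltW.
have := xy i; rewrite !ffunE => /(congr1 (fun k : 'I__ => val k)) /=.
have zq v : `|v| <= B -> (Num.truncn (z v i) < q.+1)%N.
  by move=> vB; rewrite ltnS; apply: le_truncn; have /andP[] := zP v i vB.
rewrite !inordK ?zq// => tE.
have /andP[zx0 _] := zP x i xB; have /andP[zy0 _] := zP y i yB.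
have := truncn_itv zx0; have := truncn_itv zy0; rewrite tE => zy zx.
have : `|z x i - z y i| <= 1 by rewrite ler_norml; move: zx zy; rewrite -natr1; lra.
rewrite /z -mulrBl normrM [X in _ * X]gtr0_norm ?invr_gt0// ler_pdivrMr// mul1r.
by rewrite !mxE; congr (`|_| <= _); ring.
Qed.

End GridCode.

Section UniformAtlas.
Context {R : realType} {X : metricType R} {n : nat}.

Lemma uniform_atlas (A F : set (chart R X n)) : compact [set: X] ->
  bilipschitz_smooth_atlas A F ->
  exists (N : nat) (phi : 'I_N -> chart R X n) (L B : R),
  [/\ 1 <= L /\ 0 <= B, forall x, exists k, chart_dom (phi k) x,
      forall k x y, chart_dom (phi k) x -> chart_dom (phi k) y ->
        mdist x y <= L * `|chart_map (phi k) x - chart_map (phi k) y| /\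
        `|chart_map (phi k) x - chart_map (phi k) y| <= L * mdist x y &
      forall k x, chart_dom (phi k) x -> `|chart_map (phi k) x| <= B].
Proof.
move=> cX [finF _ covF lipF].
have /finite_seqP[s sF] : finite_set (F : set {classic chart R X n}) by [].
have [D HD] := compact_mdist_bounded cX.
pose phi (k : 'I_(size s)) : chart R X n := tnth (in_tuple s) k.
have phiF k : F (phi k) by rewrite sF /= mem_tnth.
have /choice[L LP] : forall k, exists L : R, 0 < L /\
    forall x y, chart_dom (phi k) x -> chart_dom (phi k) y ->
      L^-1 * mdist x y <= `|chart_map (phi k) x - chart_map (phi k) y|
        <= L * mdist x y.
  by move=> k; have [L L0 LP] := lipF _ (phiF k); exists L.
have /choice[b bP] : forall k, exists b : R,
    forall x, chart_dom (phi k) x -> `|chart_map (phi k) x| <= b.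
  move=> k; have [[x0 x0k]|nx] := pselect (exists x, chart_dom (phi k) x); last first.
    by exists 0 => x xk; exfalso; apply: nx; exists x.
  exists (`|chart_map (phi k) x0| + L k * D) => x xk.
  rewrite -(subrK (chart_map (phi k) x0) (chart_map (phi k) x)) addrC.
  rewrite (le_trans (ler_normD _ _))// lerD2l.
  have [Lk0 /(_ _ _ xk x0k)/andP[_ /le_trans]] := LP k; apply.
  by rewrite ler_pM2l.
pose Lm := \big[Num.max/1]_k L k; pose Bm := \big[Num.max/0]_k b k.
have LLm k : L k <= Lm by exact: le_bigmax.
have bBm k : b k <= Bm by exact: le_bigmax.
have Lm1 : 1 <= Lm by exact: bigmax_ge_id.
exists (size s), phi, Lm, Bm; split.
- by split=> //; exact: bigmax_ge_id.
- move=> x; have : [set: X] x by [].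
  rewrite -covF => -[psi /=]; rewrite sF /= => /(tnthP (in_tuple s))[k kE] xpsi.
  by exists k; rewrite /phi -kE.
- move=> k x y xk yk; have [Lk0 /(_ _ _ xk yk)/andP[h1 h2]] := LP k; split.
    move: h1; rewrite ler_pdivrMl// => /le_trans; apply.
    by rewrite ler_wpM2r.
  by apply: le_trans h2 _; rewrite ler_wpM2r// mdist_ge0.
- by move=> k x xk; apply: le_trans (bP _ _ xk) _.
Qed.

(** Cells of side [eps / L] in the charts have diameter at most [eps] in the
    manifold, and their number is at most a constant times [eps ^- n]. *)
Lemma upper_mdim_le (A F : set (chart R X n)) (f : X -> X) :
  [set: X] !=set0 -> compact [set: X] -> bilipschitz_smooth_atlas A F ->
  (upper_mdim f <= (n%:R)%:E)%E.
Proof.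
move=> [x0 _] cX AF.
have [N [phi [L [B [[L1 B0] cov lip bd]]]]] := uniform_atlas cX AF.
have L0 : 0 < L by apply: lt_le_trans L1.
have [k0 _] := cov x0.
have N0 : (0 < N)%N by case: N k0 {phi cov lip bd} => [[]|].
pose C : R := N%:R * (2 * B * L + 1) ^+ n.
have C0 : 0 < C.
  by rewrite mulr_gt0 ?ltr0n// exprn_gt0// ltr_wpDl// !mulr_ge0// ltW.
have entropy eps : 0 < eps < 1 ->
    (eps_entropy f eps <= (ln C + n%:R * `|ln eps|)%:E)%E.
  move=> /andP[e0 e1].
  have [q [code [qle codeP]]] := @grid_code R n B (eps / L) B0 (divr_gt0 e0 L0).
  have /choice[k kP] := cov.
  pose cd x := (k x, code (chart_map (phi (k x)) x)).
  have Z0 : (0 < #|{: 'I_N * {ffun 'I_n -> 'I_q.+1}}|)%N.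
    by apply/card_gt0P; exists (cd x0).
  apply: le_trans (@eps_entropy_le R X f _ cd eps (ltW e0) Z0 _) _.
    move=> x y [kxy cxy]; have yk : chart_dom (phi (k x)) y by rewrite kxy.
    have [+ _] := lip (k x) x y (kP x) yk; move=> /le_trans; apply; rewrite mulrC -ler_pdivlMr//.
    by apply: codeP; [exact: bd|exact: bd|rewrite cxy kxy].
  rewrite lee_fin card_prod card_ord card_ffun !card_ord.
  have -> : ln C + n%:R * `|ln eps| = ln (C / eps ^+ n).
    rewrite ln_div ?posrE ?exprn_gt0// lnXn// ltr0_norm ?ln_lt0 ?e0//.
    by rewrite mulrN mulr_natl.
  rewrite ler_ln ?posrE ?divr_gt0 ?exprn_gt0//; last first.
    by rewrite ltr0n muln_gt0 N0 expn_gt0.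
  rewrite natrM natrX /C -mulrA ler_pM2l ?ltr0n// -expr_div_n.
  rewrite lerXn2r ?nnegrE//.
    by rewrite divr_ge0 ?(ltW e0)// addr_ge0// !mulr_ge0// ltW.
  have e1' : 1 <= eps^-1 by rewrite -[leLHS]invr1 lef_pV2 ?posrE// ltW.
  by apply: le_trans qle _; rewrite invf_div mulrA [leRHS]mulrDl mul1r lerD2l.
apply/lee_addgt0Pr => d d0.
pose e0 : R := Num.min (1 / 2) (expR (- (`|ln C| / d))).
have e00 : 0 < e0 by rewrite lt_min expR_gt0 andbT; lra.
apply: ereal_inf_le.
exists (ereal_sup ((fun eps : R => (eps_entropy f eps / (`|ln eps|%R)%:E)%E) @`
    [set eps | 0 < eps < e0])).
  exists [set eps | 0 < eps < e0] => //.
  near=> eps; apply/andP; split; near: eps.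
    exact: nbhs_right_gt.
  exact: nbhs_right_lt.
apply: ge_ereal_sup => _ [eps /andP[eps0 epse] <-].
have eps1 : 0 < eps < 1.
  by rewrite eps0; apply: lt_le_trans epse _; rewrite ge_min; apply/orP; left; lra.
have lneps : 0 < `|ln eps| by rewrite normr_gt0 lt_eqF// ln_lt0.
rewrite inver gt_eqF// lee_pdivrMr// (le_trans (entropy _ eps1))//.
rewrite -EFinD -EFinM lee_fin mulrDl addrC lerD2l.
apply: le_trans (ler_norm _) _; rewrite mulrC -ler_pdivrMr//.
have : ln eps <= - (`|ln C| / d).
  rewrite -ler_expR lnK ?posrE//; apply: le_trans (ltW epse) _.
  by rewrite ge_min lexx orbT.
by move=> lne; rewrite [leRHS]ltr0_norm ?ln_lt0//; lra.
Unshelve. all: by end_near. Qed.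

End UniformAtlas.

(** * Cubes in charts *)

Lemma near_eq_continuous (T U : topologicalType) (f g : T -> U) (x : T) :
  (\forall y \near x, f y = g y) -> {for x, continuous g} ->
  {for x, continuous f}.
Proof.
move=> fg cg; rewrite /prop_for /continuous_at (nbhs_singleton fg).
apply: cvg_trans cg; apply: near_eq_cvg.
by apply: filterS fg => y ->.
Qed.

Section ChartBasics.
Context {R : realType} {X : topologicalType} {n : nat}.
Local Notation E := 'rV[R]_n.
Implicit Type phi : chart R X n.

Definition chart_img phi : set E := chart_map phi @` chart_dom phi.

Lemma chart_map_cts phi x : chart_dom phi x ->
  {for x, continuous (chart_map phi)}.
Proof.
move=> xphi; have := chart_map_continuous (c := phi).
rewrite continuous_open_subspace; last exact: chart_dom_open.
by apply; rewrite inE.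
Qed.

Lemma chart_inv_cts phi v : chart_img phi v -> {for v, continuous (chart_inv phi)}.
Proof.
move=> vphi; have := chart_inv_continuous (c := phi).
rewrite continuous_open_subspace; last exact: chart_img_open.
by apply; rewrite inE.
Qed.

Lemma chart_inv_dom phi v : chart_img phi v -> chart_dom phi (chart_inv phi v).
Proof. by move=> [x xphi <-]; rewrite chart_mapK. Qed.

Lemma chart_invK phi v : chart_img phi v -> chart_map phi (chart_inv phi v) = v.
Proof. by move=> [x xphi <-]; rewrite chart_mapK. Qed.

Lemma chart_preimage_open phi (O : set E) : open O ->
  open [set x | chart_dom phi x /\ O (chart_map phi x)].
Proof.
move=> oO; rewrite openE => x [xphi Ox]; rewrite /interior.
have := chart_map_cts xphi; move/(_ O (open_nbhs_nbhs (conj oO Ox))) => xO.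
have xd : nbhs x (chart_dom phi).
  by apply: open_nbhs_nbhs; split => //; exact: chart_dom_open.
by apply: filterS2 xd xO => y.
Qed.

Lemma chart_preimage_closed phi (K : set E) : hausdorff_space X ->
  compact K -> K `<=` chart_img phi ->
  closed [set x | chart_dom phi x /\ K (chart_map phi x)].
Proof.
move=> hX cK Kphi.
suff -> : [set x | chart_dom phi x /\ K (chart_map phi x)] = chart_inv phi @` K.
  apply: compact_closed => //; apply: continuous_compact => //.
  by apply: continuous_in_subspaceT => v /set_mem /Kphi; exact: chart_inv_cts.
apply/seteqP; split=> [x [xphi Kx]|_ [v Kv <-]].
  by exists (chart_map phi x) => //; rewrite chart_mapK.
by split; [exact/chart_inv_dom/Kphi|rewrite chart_invK//; exact: Kphi].
Qed.

End ChartBasics.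

Lemma cball_closed (R : realType) (V : normedModType R) (c : V) (r : R) :
  closed [set v | `|v - c| <= r].
Proof.
have -> : [set v | `|v - c| <= r] = (fun v : V => `|v - c|) @^-1` [set x | x <= r].
  by [].
apply: closed_comp => [v _|]; last exact: closed_le.
apply: (@lipschitz_cts _ _ _ _ 1) => x y.
by rewrite mul1r (le_trans (ler_dist_dist _ _))// opprB addrA subrK.
Qed.

Lemma cball_compact (R : realType) (n : nat) (c : 'rV[R]_n) (r : R) :
  compact [set v | `|v - c| <= r].
Proof.
apply: bounded_closed_compact; last exact: cball_closed.
exists (`|c| + r); split; first exact: num_real.
move=> M cM v /= vc; apply: le_trans (ltW cM).
by rewrite -(subrK c v) addrC (le_trans (ler_normD _ _))// lerD2l.
Qed.

(** Two concentric open cubes in the image of a chart. Points are moved within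
    the smaller one; the larger one leaves room for the squeezing map to return
    to the identity. *)
Record cube (R : realType) (X : topologicalType) (n : nat) := Cube {
  cube_chart : chart R X n ;
  cube_center : 'rV[R]_n ;
  cube_inner : R ;
  cube_outer : R ;
  cube_lt : 0 < cube_inner < cube_outer ;
  cube_img : forall v, `|v - cube_center| <= cube_outer ->
    chart_img cube_chart v
}.

Section Cubes.
Context {R : realType} {X : topologicalType} {n : nat}.
Local Notation E := 'rV[R]_n.
Implicit Type C : cube R X n.

Definition cube_map C := chart_map (cube_chart C).
Definition cube_inv C := chart_inv (cube_chart C).

Definition core C : set X := [set x | chart_dom (cube_chart C) x /\
  `|cube_map C x - cube_center C| < cube_inner C].

Definition hull C : set X := [set x | chart_dom (cube_chart C) x /\
  `|cube_map C x - cube_center C| < cube_outer C].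

Lemma core_hull C : core C `<=` hull C.
Proof.
move=> x [xC xin]; split=> //; apply: lt_trans xin _.
by have /andP[] := cube_lt C.
Qed.

Lemma norm_ball_open (c : E) (r : R) : open [set v : E | `|v - c| < r].
Proof.
have -> : [set v : E | `|v - c| < r] = ball c r.
  by rewrite -ball_normE; apply/seteqP; split=> v /=; rewrite distrC.
exact: ball_open.
Qed.

Lemma core_open C : open (core C).
Proof.
exact: (@chart_preimage_open _ _ _ (cube_chart C) _
          (@norm_ball_open (cube_center C) (cube_inner C))).
Qed.

(** Away from the preimage of the closed outer cube, which is compact and hence
    closed, the lifted map is the identity; this makes it continuous at the
    boundary of the domain of the chart. *)
Lemma cube_homeo C (h h' : E -> E) : hausdorff_space X ->
  supp_homeo (ball (cube_center C) (cube_outer C) : set E) h h' ->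
  exists M M', supp_homeo (hull C) M M' /\
    forall x, hull C x -> cube_map C (M x) = h (cube_map C x).
Proof.
move=> hX hC; set phi := cube_chart C; set V : set E := ball _ _ in hC.
have VP v : V v <-> `|v - cube_center C| < cube_outer C.
  by rewrite /V -ball_normE /= distrC.
pose lift (k : E -> E) x :=
  if pselect (chart_dom phi x) then chart_inv phi (k (chart_map phi x)) else x.
have img k k' x : supp_homeo V k k' -> chart_dom phi x ->
    chart_img phi (k (chart_map phi x)).
  move=> kV xphi; have [Vx|Vx] := pselect (V (chart_map phi x)).
    by apply: cube_img; have /VP/ltW := supp_homeo_stable kV Vx.
  by have [_ _ _ _ ->//] := kV; exists x.
have liftE k x : chart_dom phi x -> lift k x = chart_inv phi (k (chart_map phi x)).
  by move=> xphi; rewrite /lift; case: pselect.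
have lift_out k x : ~ chart_dom phi x -> lift k x = x.
  by move=> xphi; rewrite /lift; case: pselect.
have lift_id k k' x : supp_homeo V k k' -> ~ (chart_dom phi x /\
    V (chart_map phi x)) -> lift k x = x.
  move=> kV nVx; rewrite /lift; case: pselect => // xphi.
  have [_ _ _ _ ->] := kV; first by rewrite chart_mapK.
  by move=> Vx; apply: nVx.
have lift_cts k k' : supp_homeo V k k' -> continuous (lift k).
  move=> kV x; have [xphi|xphi] := pselect (chart_dom phi x).
    apply: (@near_eq_continuous _ _ _ (chart_inv phi \o (k \o chart_map phi))).
      have : nbhs x (chart_dom phi).
        by apply: open_nbhs_nbhs; split => //; exact: chart_dom_open.
      by apply: filterS => y; exact: liftE.
    apply: continuous_comp; last exact: chart_inv_cts (img _ _ _ kV xphi).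
    apply: continuous_comp; first exact: chart_map_cts.
    by have [ck _ _ _ _] := kV; exact: ck.
  apply: (@near_eq_continuous _ _ _ id); last exact: cvg_id.
  pose K := [set v | `|v - cube_center C| <= cube_outer C].
  have cK : closed [set x | chart_dom phi x /\ K (chart_map phi x)].
    by apply: chart_preimage_closed; [|exact: cball_compact|exact: cube_img].
  have : nbhs x (~` [set x | chart_dom phi x /\ K (chart_map phi x)]).
    by apply: open_nbhs_nbhs; split; [exact: closed_openC|case].
  apply: filterS => y nKy; apply: lift_id kV _ => -[yphi /VP/ltW Vy].
  by apply: nKy.
have liftK k k' : supp_homeo V k k' -> cancel (lift k) (lift k').
  move=> kV x; have [xphi|xphi] := pselect (chart_dom phi x); last first.
    by rewrite !lift_out.
  have ki := img _ _ _ kV xphi.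
  rewrite [lift k x]liftE// liftE; last exact: chart_inv_dom.
  by rewrite chart_invK//; have [_ _ -> _ _] := kV; rewrite chart_mapK.
have h'C := supp_homeo_sym hC.
exists (lift h), (lift h'); split.
  split; [exact: lift_cts hC|exact: lift_cts h'C|exact: liftK|exact: liftK|].
  by move=> x nx; apply: lift_id hC _ => -[xphi /VP Vx]; apply: nx.
move=> x [xphi _]; rewrite liftE// /cube_map chart_invK//.
exact: img hC xphi.
Qed.

Lemma cubes_homeo (I : finType) (C : I -> cube R X n) (h h' : I -> E -> E) :
  hausdorff_space X ->
  (forall i j x, hull (C i) x -> hull (C j) x -> i = j) ->
  (forall i, supp_homeo
     (ball (cube_center (C i)) (cube_outer (C i)) : set E) (h i) (h' i)) ->
  exists M M', supp_homeo (\bigcup_i hull (C i)) M M' /\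
    forall i x, hull (C i) x ->
      hull (C i) (M x) /\ cube_map (C i) (M x) = h i (cube_map (C i) x).
Proof.
move=> hX dC hC.
have /choice[m mP] : forall i, exists m : (X -> X) * (X -> X),
    supp_homeo (hull (C i)) m.1 m.2 /\
    forall x, hull (C i) x -> cube_map (C i) (m.1 x) = h i (cube_map (C i) x).
  by move=> i; have [M [M' MP]] := cube_homeo hX (hC i); exists (M, M').
have [M [M' [MC ME]]] := supp_homeo_glue dC (fun i => (mP i).1).
exists M, M'; split=> // i x xC; rewrite (ME i)//; split; last exact: (mP i).2.
exact: supp_homeo_stable (mP i).1 xC.
Qed.

End Cubes.

(** * A cycle of cubes *)

Lemma finite_pos_lower_bound (R : realType) (I : finType) (e : I -> R) :
  (forall i, 0 < e i) -> exists2 d, 0 < d & forall i, d <= e i.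
Proof.
move=> e0; exists (\big[Num.min/1]_i e i); last by move=> i; exact: bigmin_le.
by apply/bigmin_gtP; split.
Qed.

Section Recurrence.
Context {R : realType} {X : metricType R} {n : nat}.
Hypothesis cX : compact [set: X].
Local Notation E := 'rV[R]_n.

Lemma iter_injective (T : Type) (g : T -> T) k : injective g -> injective (iter k g).
Proof. by move=> gI; elim: k => [//|k IHk] x y /= /gI /IHk. Qed.

(** The orbit of any point has a limit point [z] by compactness, and it enters each
    neighbourhood of [z] infinitely often. *)
Lemma first_return (g : X -> X) : [set: X] !=set0 ->
  exists z, forall B : set X, open B -> B z -> exists y p,
    [/\ B y, B (iter p.+1 g y) & forall k, (0 < k <= p)%N -> ~ B (iter k g y)].
Proof.
move=> [x0 _]; pose u k := iter k g x0.
have [z [_ zu]] := cX (F := u @ \oo) _ filterT.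
exists z => B oB Bz.
have hit M : exists2 k, (M <= k)%N & B (u k).
  have [] := zu (u @` [set k | (M <= k)%N]) B.
  - by exists M => // k /= Mk; exists k.
  - by apply: open_nbhs_nbhs.
  by move=> _ [[k /= Mk <-] Bk]; exists k.
have [i _ Bi] := hit 0%N; have [j ij Bj] := hit i.+1.
pose P q := `[< B (iter q.+1 g (u i)) >].
have exP : exists q, P q.
  exists (j - i).-1; apply/asboolP; rewrite prednK ?subn_gt0// -iterD subnK//.
  exact: ltnW.
case: (ex_minnP exP) => p /asboolP Bp pmin.
exists (u i), p; split => // k /andP[k0 kp] Bk.
have : (p <= k.-1)%N by apply: pmin; apply/asboolP; rewrite prednK.
by rewrite -ltnS prednK// ltnNge kp.
Qed.

Section Chain.
Context {N : nat} (phi : 'I_N -> chart R X n) (L : R).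
Hypothesis L1 : 1 <= L.
Hypothesis cov : forall x, exists k, chart_dom (phi k) x.
Hypothesis lip : forall k x y, chart_dom (phi k) x -> chart_dom (phi k) y ->
  mdist x y <= L * `|chart_map (phi k) x - chart_map (phi k) y| /\
  `|chart_map (phi k) x - chart_map (phi k) y| <= L * mdist x y.

Lemma small_cube_radius (x : X) (d : R) : 0 < d -> exists k r,
  [/\ 0 < r, chart_dom (phi k) x,
      forall v, `|v - chart_map (phi k) x| <= r -> chart_img (phi k) v &
      forall z, chart_dom (phi k) z ->
        `|chart_map (phi k) z - chart_map (phi k) x| <= r -> mdist x z < d].
Proof.
move=> d0; have L0 : 0 < L by apply: lt_le_trans L1.
have [k xk] := cov x; exists k.
have /nbhs_ballP[e /= e0 eimg] : nbhs (chart_map (phi k) x) (chart_img (phi k)).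
  by apply: open_nbhs_nbhs; split; [exact: chart_img_open|exists x].
pose r := Num.min (e / 2) (d / L / 2).
have re : r <= e / 2 by rewrite ge_min lexx.
have rd : r <= d / L / 2 by rewrite ge_min lexx orbT.
exists r; split=> //.
- by rewrite lt_min !divr_gt0.
- by move=> v vr; apply: eimg; rewrite -ball_normE /= distrC; lra.
- move=> z zk zr; rewrite metric_sym; have [/le_lt_trans + _] := lip zk xk; apply.
  rewrite mulrC -ltr_pdivlMr//; apply: le_lt_trans zr _.
  by have : 0 < d / L by [rewrite divr_gt0]; lra.
Qed.

(** Take the orbit of a point near a limit point, up to its first return. Its points
    are distinct and only the first and the last lie near the limit point, so they
    can be enclosed in disjoint small cubes, with one cube for both of these. *)
Lemma cycle_of_cubes (g : X -> X) (d : R) : injective g ->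
  [set: X] !=set0 -> 0 < d ->
  exists p (C : 'I_p.+1 -> cube R X n) (y : 'I_p.+1 -> X)
    (sigma : 'I_p.+1 -> 'I_p.+1),
  [/\ injective sigma,
      forall l, exists k, cube_chart (C l) = phi k,
      forall l, core (C l) (y l) /\ core (C (sigma l)) (g (y l)),
      forall l x x', hull (C l) x -> hull (C l) x' -> mdist x x' < d &
      forall l l' x, hull (C l) x -> hull (C l') x -> l = l'].
Proof.
move=> gI X0 d0; have [z zret] := first_return g X0.
have d20 : 0 < d / 2 by rewrite divr_gt0.
have [k0 [r [r0 zk rimg rsmall]]] := small_cube_radius z d20.
pose f0 := chart_map (phi k0).
pose patch s := [set x | chart_dom (phi k0) x /\ `|f0 x - f0 z| < s].
have oB : open (patch r).
  exact: (@chart_preimage_open _ _ _ (phi k0) _ (@norm_ball_open R n (f0 z) r)).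
have [|y0 [p [By Bret Bout]]] := zret _ oB.
  by split=> //; rewrite subrr normr0.
set yr := iter p.+1 g y0 in Bret.
(* Radii between the distance of [y0] and [yr] from [z] and the radius [r] of the
   neighbourhood: the intermediate points stay off the closed cube [K]. *)
pose m := Num.max `|f0 y0 - f0 z| `|f0 yr - f0 z|.
have mr : m < r by rewrite gt_max By.2 Bret.2.
have m0 : 0 <= m by rewrite le_max normr_ge0.
have [ym yrm] : `|f0 y0 - f0 z| <= m /\ `|f0 yr - f0 z| <= m.
  by rewrite !le_max !lexx orbT.
pose r1 := (2 * m + r) / 3; pose r2 := (m + 2 * r) / 3.
have r12 : 0 < r1 < r2 by rewrite /r1 /r2; lra.
have r2r : r2 < r by rewrite /r2; lra.
have r2img v : `|v - f0 z| <= r2 -> chart_img (phi k0) v.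
  by move=> vr; apply: rimg; rewrite (le_trans vr)// ltW.
pose C0 := Cube r12 r2img.
pose K := [set x | chart_dom (phi k0) x /\ `|f0 x - f0 z| <= r2].
have cK : closed K.
  have := @chart_preimage_closed _ _ _ (phi k0) _ (@metric_hausdorff _ X)
    (@cball_compact _ _ (f0 z) r2).
  exact.
pose y (l : 'I_p.+1) := iter l g y0.
have y_out (l : 'I_p.+1) : l != ord0 -> ~ K (y l).
  move=> l0 [yk yr2]; apply: (Bout l); last by split=> //; exact: le_lt_trans r2r.
  by rewrite lt0n l0 /= -ltnS.
have yI (l l' : 'I_p.+1) : (l < l')%N -> y l != y l'.
  move=> ll'; apply/eqP; rewrite /y -(subnKC (ltnW ll')) iterD.
  move=> /(iter_injective gI) yy.
  apply: (Bout (l' - l)%N); last by rewrite -yy.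
  by rewrite subn_gt0 ll' /= (leq_trans (leq_subr _ _))// -ltnS.
have /choice[e eP] : forall l, exists e : R, 0 < e /\
    (l != ord0 -> forall x, mdist (y l) x < e -> ~ K x).
  move=> l; have [->|l0] := eqVneq l ord0; first by exists 1.
  have : nbhs (y l) (~` K).
    by apply: open_nbhs_nbhs; split; [exact: closed_openC|exact: y_out].
  move=> /nbhs_ballP[e /= e0 eK]; exists e; split=> // _ x yx; apply: eK.
  by rewrite ballEmdist.
have [e1 e10 e1P] := finite_pos_lower_bound (fun l => (eP l).1).
pose gap (ll : 'I_p.+1 * 'I_p.+1) : R :=
  if ll.1 == ll.2 then 1 else mdist (y ll.1) (y ll.2) / 2.
have gap0 ll : 0 < gap ll.
  rewrite /gap; case: ifP => // /negbT; rewrite neq_ltn => ll12.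
  by rewrite divr_gt0// mdist_gt0; case/orP: ll12 => /yI; rewrite // eq_sym.
have [e2 e20 e2P] := finite_pos_lower_bound gap0.
pose e3 := Num.min (d / 2) (Num.min e1 e2).
have e30 : 0 < e3 by rewrite !lt_min d20 e10.
have [e3d e3e1 e3e2] : [/\ e3 <= d / 2, e3 <= e1 & e3 <= e2].
  by rewrite /e3 !ge_min !lexx !orbT.
have /choice[C CP] : forall l, exists C : cube R X n,
  [/\ exists k, cube_chart C = phi k, core C (y l),
      l == ord0 -> core C yr /\ hull C `<=` K,
      l != ord0 -> forall x, hull C x -> mdist (y l) x < e3 &
      forall x x', hull C x -> hull C x' -> mdist x x' < d].
  move=> l; have [->|l0] := eqVneq l ord0.
    exists C0; split=> //.
    - by exists k0.
    - by split; [exact: By.1|apply: le_lt_trans ym _; rewrite /= /r1; lra].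
    - move=> _; split.
        by split; [exact: Bret.1|apply: le_lt_trans yrm _; rewrite /= /r1; lra].
      by move=> x [xk xr]; split=> //; exact: ltW.
    - move=> x x' [xk xr] [x'k x'r]; apply: le_lt_trans (metric_triangle x z x') _.
      rewrite [ltRHS]splitr (metric_sym x) ltrD//; apply: rsmall => //.
        by apply: ltW; exact: lt_trans xr r2r.
      by apply: ltW; exact: lt_trans x'r r2r.
  have [k [s [s0 yk simg ssmall]]] := small_cube_radius (y l) e30.
  have s12 : 0 < s / 2 < s by lra.
  exists (Cube s12 simg); split=> //.
  - by exists k.
  - by split=> //=; rewrite subrr normr0; lra.
  - by move=> _ x [xk xs]; apply: ssmall => //; exact: ltW.
  - move=> x x' [xk xr] [x'k x'r]; apply: le_lt_trans (metric_triangle x (y l) x') _.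
    rewrite [ltRHS]splitr (metric_sym x) ltrD//; apply: lt_le_trans e3d;
      by apply: ssmall => //; exact: ltW.
exists p, C, y, (@ordS p.+1); split.
- exact: can_inj (@ordSK p.+1).
- by move=> l; have [] := CP l.
- move=> l; split; first by have [] := CP l.
  have [lp|lp] := eqVneq (l : nat) p.
    have l0 : ordS l == ord0 by apply/eqP/val_inj; rewrite /= lp modnn.
    have [_ _ /(_ l0)[+ _] _ _] := CP (ordS l).
    by rewrite /yr /y lp.
  have [_ + _ _ _] := CP (ordS l).
  rewrite /y /= modn_small// ltnS ltn_neqAle lp /=.
  by rewrite -ltnS.
- by move=> l x x' xl x'l; have [_ _ _ _] := CP l; apply.
have out l l' x : l != ord0 -> hull (C l) x -> hull (C l') x -> l = l'.
  move=> l0 xl xl'; have [_ _ _ /(_ l0 _ xl) xe _] := CP l.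
  have [l'0|l'0] := eqVneq l' ord0.
    have [_ _ /(_ (introT eqP l'0))[_ /(_ _ xl') Kx] _ _] := CP l'.
    exfalso; apply: (eP l).2 Kx => //; apply: lt_le_trans xe _.
    exact: le_trans (e1P l).
  have [_ _ _ /(_ l'0 _ xl') xe' _] := CP l'.
  apply/eqP/negPn/negP => ll'.
  have := e2P (l, l'); rewrite /gap /= (negbTE ll').
  have := metric_triangle (y l) x (y l'); rewrite (metric_sym x); lra.
move=> l l' x xl xl'; have [l0|l0] := eqVneq l ord0; last exact: out xl xl'.
have [l'0|l'0] := eqVneq l' ord0; first by rewrite l0 l'0.
by apply/esym; exact: out xl' xl.
Qed.

End Chain.

End Recurrence.

(** * Horseshoes that persist *)

(** The height, that is the coordinate [i0], serves as the expanding direction of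
    the horseshoe, and the pieces [entry w, exit w] of the curve as its branches. *)
Record track (R : realType) (X : topologicalType) (n : nat) (i0 : 'I_n)
    (I : finType) := Track {
  track_cube :> cube R X n ;
  curve : R -> 'rV[R]_n ;
  left_end : R ;
  right_end : R ;
  entry : I -> R ;
  exit : I -> R ;
  curve_lip : exists K, forall s t, `|curve s - curve t| <= K * `|s - t| ;
  curve_graph : forall t, curve t ord0 i0 = t ;
  left_right : left_end < right_end ;
  entry_exit : forall w, left_end < entry w < exit w /\ exit w < right_end
}.

Section CtsComparison.
Context {R : realType} {T : topologicalType}.
Variables (f : T -> R) (a : R).
Hypothesis cf : continuous f.

Lemma cts_lt_open : open [set x | f x < a].
Proof. exact: (open_comp (fun v _ => @cf v) (@open_lt _ _)). Qed.

Lemma cts_gt_open : open [set x | a < f x].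
Proof. exact: (open_comp (fun v _ => @cf v) (@open_gt _ _)). Qed.

Lemma cts_le_closed : closed [set x | f x <= a].
Proof. exact: (closed_comp (fun v _ => @cf v) (@closed_le _ _)). Qed.

Lemma cts_ge_closed : closed [set x | a <= f x].
Proof. exact: (closed_comp (fun v _ => @cf v) (@closed_ge _ _)). Qed.

End CtsComparison.

Section RobustHorseshoe.
Context {R : realType} {X : metricType R} {n : nat} {i0 : 'I_n} {I : finType}.
Local Notation E := 'rV[R]_n.
Implicit Types (tr : track R X i0 I) (beta : R).

(** The distance is taken to the point of the curve at the same height, because
    this is the distance that the squeezing map controls. *)
Definition tube tr beta s t : set X := [set x | chart_dom (cube_chart tr) x /\
  [set v : E | s <= v ord0 i0 <= t /\ `|v - curve tr (v ord0 i0)| <= beta]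
    (cube_map tr x)].

(** A path in the gate can pass from the low to the high side only along the
    curve. *)
Definition gate tr beta : set X := [set x | chart_dom (cube_chart tr) x /\
  [set v : E | v ord0 i0 < left_end tr \/ right_end tr < v ord0 i0 \/
    `|v - curve tr (v ord0 i0)| < beta] (cube_map tr x)].

Definition low_side tr : set X := [set x | chart_dom (cube_chart tr) x /\
  [set v : E | v ord0 i0 < left_end tr] (cube_map tr x)].

Definition high_side tr : set X := [set x | chart_dom (cube_chart tr) x /\
  [set v : E | right_end tr < v ord0 i0] (cube_map tr x)].

Lemma coord_cts (i : 'I_n) : continuous (fun v : E => v ord0 i).
Proof. exact: coord_continuous. Qed.

Lemma curve_dist_cts tr : continuous (fun v : E => `|v - curve tr (v ord0 i0)|).
Proof.
have [K curveK] := curve_lip tr.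
have K0 : 0 <= K.
  by have := le_trans (normr_ge0 _) (curveK 1 0); rewrite subr0 normr1 mulr1.
apply: (@lipschitz_cts _ _ _ _ (1 + K)) => v w.
rewrite (le_trans (ler_dist_dist _ _))//.
have -> : v - curve tr (v ord0 i0) - (w - curve tr (w ord0 i0)) =
    (v - w) - (curve tr (v ord0 i0) - curve tr (w ord0 i0)).
  by apply/rowP => j; rewrite !mxE; ring.
rewrite (le_trans (ler_normB _ _))// mulrDl mul1r lerD2l.
by rewrite (le_trans (curveK _ _))// ler_wpM2l// coord_dist_le.
Qed.

Lemma curve_cts tr : continuous (curve tr).
Proof. by have [K curveK] := curve_lip tr; exact: lipschitz_cts curveK. Qed.

Lemma gate_open tr beta : open (gate tr beta).
Proof.
apply: (@chart_preimage_open _ _ _ (cube_chart tr)).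
apply: openU; last apply: openU.
- exact: cts_lt_open (@coord_cts i0).
- exact: cts_gt_open (@coord_cts i0).
- exact: cts_lt_open (@curve_dist_cts tr).
Qed.

Lemma low_side_open tr : open (low_side tr).
Proof.
apply: (@chart_preimage_open _ _ _ (cube_chart tr)).
exact: cts_lt_open (@coord_cts i0).
Qed.

Lemma high_side_open tr : open (high_side tr).
Proof.
apply: (@chart_preimage_open _ _ _ (cube_chart tr)).
exact: cts_gt_open (@coord_cts i0).
Qed.

Lemma tube_closed tr beta s t : left_end tr <= s -> t <= right_end tr ->
  (forall t' v, left_end tr <= t' <= right_end tr ->
    `|v - curve tr t'| <= beta -> `|v - cube_center tr| < cube_inner tr) ->
  closed (tube tr beta s t).
Proof.
move=> ls tr_ margin.
have inC (v : E) : s <= v ord0 i0 <= t /\ `|v - curve tr (v ord0 i0)| <= beta ->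
    `|v - cube_center tr| <= cube_outer tr.
  move=> [vst vb]; have /andP[_ /ltW] := cube_lt tr; apply: le_trans.
  by apply: ltW; apply: margin vb; lra.
apply: (@chart_preimage_closed _ _ _ (cube_chart tr)).
- exact: metric_hausdorff.
- apply: (@subclosed_compact _ _ [set v : E | `|v - cube_center tr| <= cube_outer tr]).
  + have -> : ([set v : E | s <= v ord0 i0 <= t /\
          `|v - curve tr (v ord0 i0)| <= beta] : set E) =
      ([set v : E | s <= v ord0 i0] : set E) `&`
      ([set v : E | v ord0 i0 <= t] : set E) `&`
      ([set v : E | `|v - curve tr (v ord0 i0)| <= beta] : set E).
      by apply/seteqP; split=> v /=; [move=> [/andP[]]|move=> [[-> ->]]].
    apply: closedI; first apply: closedI.
    * exact: cts_ge_closed (@coord_cts i0).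
    * exact: cts_le_closed (@coord_cts i0).
    * exact: cts_le_closed (@curve_dist_cts tr).
  + exact: cball_compact.
  + exact: inC.
- by move=> v /inC; exact: cube_img.
Qed.

Context {T : finType} (tr : T -> track R X i0 I) (sigma : T -> T).

Definition maps_across (beta : R) (f : X -> X) := forall l w,
  [/\ forall x, tube (tr l) beta (entry (tr l) w) (exit (tr l) w) x ->
        gate (tr (sigma l)) beta (f x),
      forall x, tube (tr l) beta (entry (tr l) w) (entry (tr l) w) x ->
        low_side (tr (sigma l)) (f x) &
      forall x, tube (tr l) beta (exit (tr l) w) (exit (tr l) w) x ->
        high_side (tr (sigma l)) (f x)].

(** Every clause of [maps_across] sends a compact set into an open set. *)
Lemma maps_across_robust beta f : compact [set: X] ->
  (forall l t v, left_end (tr l) <= t <= right_end (tr l) ->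
    `|v - curve (tr l) t| <= beta ->
    `|v - cube_center (tr l)| < cube_inner (tr l)) ->
  continuous f -> maps_across beta f ->
  exists2 eta, 0 < eta & forall f', (forall x, mdist (f x) (f' x) < eta) ->
    maps_across beta f'.
Proof.
move=> cX margin cf fP.
have robust (K O : set X) : closed K -> open O -> (forall x, K x -> O (f x)) ->
    exists eta : R, 0 < eta /\ forall f', (forall x, mdist (f x) (f' x) < eta) ->
      forall x, K x -> O (f' x).
  move=> cK oO KO.
  have cfK : compact (f @` K).
    apply: continuous_compact; first exact: continuous_subspaceT.
    by apply: subclosed_compact cK cX _.
  have [|e e0 eO] := compact_open_margin cfK oO; first by move=> _ [x Kx <-]; exact: KO.
  exists e; split=> // f' ff' x Kx; apply: (eO (f x)); first by exists x.
  by rewrite ballEmdist /=.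
have closed_tube l w : closed (tube (tr l) beta (entry (tr l) w) (exit (tr l) w)) /\
    closed (tube (tr l) beta (entry (tr l) w) (entry (tr l) w)) /\
    closed (tube (tr l) beta (exit (tr l) w) (exit (tr l) w)).
  have [/andP[w1 w2] w3] := entry_exit (tr l) w.
  by split; [|split]; apply: (tube_closed _ _ (margin l)); lra.
have /choice[eta etaP] : forall lw : T * I, exists eta : R, 0 < eta /\
    forall f', (forall x, mdist (f x) (f' x) < eta) ->
  [/\ forall x, tube (tr lw.1) beta (entry (tr lw.1) lw.2) (exit (tr lw.1) lw.2) x ->
        gate (tr (sigma lw.1)) beta (f' x),
      forall x, tube (tr lw.1) beta (entry (tr lw.1) lw.2) (entry (tr lw.1) lw.2) x ->
        low_side (tr (sigma lw.1)) (f' x) &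
      forall x, tube (tr lw.1) beta (exit (tr lw.1) lw.2) (exit (tr lw.1) lw.2) x ->
        high_side (tr (sigma lw.1)) (f' x)].
  move=> [l w] /=; have [c1 [c2 c3]] := closed_tube l w; have [p1 p2 p3] := fP l w.
  have [e1 [e10 e1P]] := robust _ _ c1 (gate_open _ _) p1.
  have [e2 [e20 e2P]] := robust _ _ c2 (low_side_open _) p2.
  have [e3 [e30 e3P]] := robust _ _ c3 (high_side_open _) p3.
  exists (Num.min e1 (Num.min e2 e3)); rewrite !lt_min e10 e20 e30; split=> // f' ff'.
  split; [apply: e1P|apply: e2P|apply: e3P] => x; apply: lt_le_trans (ff' x) _;
    by rewrite !ge_min !lexx ?orbT.
have [e e0 eP] := finite_pos_lower_bound (fun lw => (etaP lw).1).
exists e => // f' ff' l w; apply: (etaP (l, w)).2 => x.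
exact: lt_le_trans (ff' x) (eP _).
Qed.

(** By the intermediate value theorem, a path that goes through the gate from the
    low to the high side follows each piece [entry w, exit w] of the curve, and
    the image of this part of the path is again such a path. *)
Lemma maps_across_entropy beta f (eps : R) (l : T) :
  0 < eps -> (0 < #|I|)%N -> 0 <= beta ->
  (forall l t v, left_end (tr l) <= t <= right_end (tr l) ->
    `|v - curve (tr l) t| <= beta ->
    `|v - cube_center (tr l)| < cube_inner (tr l)) ->
  (forall l w w' x y, w != w' ->
    tube (tr l) beta (entry (tr l) w) (exit (tr l) w) x ->
    tube (tr l) beta (entry (tr l) w') (exit (tr l) w') y -> eps < mdist x y) ->
  continuous f -> maps_across beta f ->
  ((ln #|I|%:R)%:E <= eps_entropy f eps)%E.
Proof.
move=> eps0 I0 beta0 margin sep cf fP.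
have [w0 _] : exists w : I, true by case/card_gt0P: I0 => w _; exists w.
pose P l (g : R -> X) (a b : R) := [/\ forall t, a <= t <= b ->
    {for t, continuous g} /\ gate (tr l) beta (g t),
    low_side (tr l) (g a) & high_side (tr l) (g b)].
pose Q l w := tube (tr l) beta (entry (tr l) w) (exit (tr l) w).
have PfE l' w (g : R -> X) (s t : R) : s <= t -> (forall x, s <= x <= t ->
      {for x, continuous g} /\ Q l' w (g x)) ->
    cube_map (tr l') (g s) ord0 i0 = entry (tr l') w ->
    cube_map (tr l') (g t) ord0 i0 = exit (tr l') w ->
    P (sigma l') (f \o g) s t.
  move=> st gQ gs gt; have [p1 p2 p3] := fP l' w; split.
  - move=> x xst; have [gx Qx] := gQ x xst; split; last exact: p1.
    by apply: continuous_comp; [exact: gx|exact: cf].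
  - apply: p2; have [|_ [? [_ ?]]] := gQ s; first by lra.
    by split=> //; split=> //; rewrite gs lexx.
  - apply: p3; have [|_ [? [_ ?]]] := gQ t; first by lra.
    by split=> //; split=> //; rewrite gt lexx.
have cross l' g a b w : a <= b -> P l' g a b -> exists s t,
    [/\ a <= s, s <= t, t <= b, P (sigma l') (f \o g) s t &
        forall x, s <= x <= t -> Q l' w (g x)].
  move=> ab [gP [ga gal] [gb gbh]]; have [/andP[w1 w2] w3] := entry_exit (tr l') w.
  pose u t := cube_map (tr l') (g t) ord0 i0.
  have [|||| s [t [as_ st tb [us ut] uP]]] :=
    @crossing R u a b (entry (tr l') w) (exit (tr l') w) ab.
  - move=> x xab; have [gx [gxd _]] := gP x xab.
    apply: (@continuous_comp _ _ _ (fun t => cube_map (tr l') (g t))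
              (fun v : E => v ord0 i0)).
      by apply: continuous_comp; [exact: gx|exact: chart_map_cts].
    exact: coord_cts.
  - by move: gal; rewrite /= /u; lra.
  - exact: ltW.
  - by move: gbh; rewrite /= /u; lra.
  have gQ x : s <= x <= t -> {for x, continuous g} /\ Q l' w (g x).
    move=> xst; have [|gx [gxd gxg]] := gP x; first by lra.
    have := uP x xst; rewrite /u => ux; split=> //; split=> //=; split=> //.
    by case: gxg => /= [|[|/ltW//]]; lra.
  exists s, t; split=> //; first exact: PfE gQ us ut.
  by move=> x /gQ[].
have [/andP[w1 w2] w3] := entry_exit (tr l) w0.
pose g0 t := cube_inv (tr l) (curve (tr l) t).
have img t : entry (tr l) w0 <= t <= exit (tr l) w0 ->
    chart_img (cube_chart (tr l)) (curve (tr l) t).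
  move=> tw; apply: cube_img; have /andP[_ /ltW] := cube_lt (tr l); apply: le_trans.
  by apply: ltW; apply: (margin _ t); [lra|rewrite subrr normr0].
have g0K t : entry (tr l) w0 <= t <= exit (tr l) w0 ->
    cube_map (tr l) (g0 t) = curve (tr l) t.
  by move=> /img; exact: chart_invK.
apply: (@horseshoe_entropy R X T I sigma f Q P eps (sigma l) (f \o g0)
  (entry (tr l) w0) (exit (tr l) w0)) => //; first exact: ltW.
apply: (PfE _ w0); first exact: ltW.
- move=> x xw; split.
    apply: continuous_comp; first exact: curve_cts.
    exact/chart_inv_cts/img.
  split; first exact/chart_inv_dom/img.
  by rewrite /= g0K// curve_graph subrr normr0.
- by rewrite g0K ?curve_graph// lexx ltW.
- by rewrite g0K ?curve_graph// lexx ltW.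
Qed.

End RobustHorseshoe.

(** * Creating a horseshoe by a small perturbation *)

(** The end points of the pieces of the curves are first moved to the low and
    high sides of the next cube; the squeezing, which respects heights, is applied
    afterwards. The order matters: how thin the tubes must be for their end faces
    to follow their centres is decided by the first map, and the second map has
    to squeeze to that thickness. *)
Lemma perturb_to_horseshoe (R : realType) (X : metricType R) (n : nat)
    (i0 i1 : 'I_n) (I T : finType) (tr : T -> track R X i0 I) (sigma : T -> T)
    (g : X -> X) (s : R) :
  i0 != i1 -> injective sigma -> continuous g -> injective g -> 0 < s ->
  (forall l l' x, hull (tr l) x -> hull (tr l') x -> l = l') ->
  (forall l t v, left_end (tr l) <= t <= right_end (tr l) ->
    `|v - curve (tr l) t| <= s ->
    `|v - cube_center (tr l)| < cube_inner (tr l) /\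
    core (tr (sigma l)) (g (cube_inv (tr l) v))) ->
  (forall l w w' t, entry (tr l) w <= t <= exit (tr l) w ->
    entry (tr l) w' <= t <= exit (tr l) w' -> w = w') ->
  exists2 beta0, 0 < beta0 & forall beta, 0 < beta <= beta0 -> exists M M',
    [/\ supp_homeo (\bigcup_l hull (tr l)) M M',
        forall l x, hull (tr l) x -> hull (tr l) (M x) &
        maps_across tr sigma beta (M \o g)].
Proof.
move=> i01 sI cg gI s0 dis margin dtime.
have hX := @metric_hausdorff _ X.
have ballP (c v : 'rV[R]_n) (r : R) : ball c r v = (`|v - c| < r) :> Prop.
  by rewrite -ball_normE /= distrC.
pose time l (bw : bool * I) := if bw.1 then exit (tr l) bw.2 else entry (tr l) bw.2.
have ee l w := entry_exit (tr l) w.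
have time_lr l bw : left_end (tr l) <= time l bw <= right_end (tr l).
  by have [/andP[? ?] ?] := ee l bw.2; rewrite /time; case: ifP => _; lra.
have time_in l bw : entry (tr l) bw.2 <= time l bw <= exit (tr l) bw.2.
  by have [/andP[? ?] ?] := ee l bw.2; rewrite /time; case: ifP => _; lra.
have timeI l : injective (time l).
  move=> [b w] [b' w'] tt; have ww : w = w'.
    have := time_in l (b', w'); rewrite -tt => h'; exact: dtime (time_in l (b, w)) h'.
  move: tt; rewrite -ww /time /=; have [/andP[? ?] ?] := ee l w.
  by case: b; case: b' => // eqt; exfalso; lra.
have margin0 l t : left_end (tr l) <= t <= right_end (tr l) ->
    `|curve (tr l) t - cube_center (tr l)| < cube_inner (tr l) /\
    core (tr (sigma l)) (g (cube_inv (tr l) (curve (tr l) t))).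
  by move=> tlr; apply: margin tlr _; rewrite subrr normr0 ltW.
have inner_outer l : cube_inner (tr l) < cube_outer (tr l).
  by have /andP[] := cube_lt (tr l).
have img l v : `|v - cube_center (tr l)| < cube_inner (tr l) ->
    chart_img (cube_chart (tr l)) v.
  by move=> /ltW vC; apply: cube_img; exact: le_trans vC (ltW (inner_outer l)).
have curve_img l t : left_end (tr l) <= t <= right_end (tr l) ->
    chart_img (cube_chart (tr l)) (curve (tr l) t).
  by move=> /margin0[/img].
pose src l bw := cube_inv (tr l) (curve (tr l) (time l bw)).
pose pt l bw := cube_map (tr (sigma l)) (g (src l bw)).
have ptI l : injective (pt l).
  move=> bw bw' pp.
  have [_ [d _]] := margin0 l _ (time_lr l bw).
  have [_ [d' _]] := margin0 l _ (time_lr l bw').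
  have /gI : g (src l bw) = g (src l bw').
    by rewrite -(chart_mapK d) -(chart_mapK d'); congr chart_inv.
  move=> /(congr1 (cube_map (tr l))); rewrite /cube_map !chart_invK;
    [|exact/curve_img/time_lr..].
  by move=> /(congr1 (fun v : 'rV_n => v ord0 i0)); rewrite !curve_graph => /timeI.
pose side l (b : bool) : set 'rV[R]_n := if b
  then [set v | right_end (tr (sigma l)) < v ord0 i0]
  else [set v | v ord0 i0 < left_end (tr (sigma l))].
have side_open l b : open (side l b).
  by case: b; [exact: cts_gt_open (@coord_cts _ _ i0)|
               exact: cts_lt_open (@coord_cts _ _ i0)].
have side_meet l b : side l b `&`
    ball (cube_center (tr (sigma l))) (cube_inner (tr (sigma l))) !=set0.
  have lr := left_right (tr (sigma l)).
  pose t := if b then right_end (tr (sigma l)) else left_end (tr (sigma l)).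
  pose e : R := if b then s else - s.
  pose v : 'rV[R]_n := curve (tr (sigma l)) t + e *: delta_mx ord0 i0.
  have [||vC _] := margin (sigma l) t v.
  - by rewrite /t; case: (b); lra.
  - rewrite /v addrC addKr normrZ.
    rewrite (_ : `|e| = s); last by rewrite /e; case: (b); rewrite ?normrN gtr0_norm.
    by rewrite ler_piMr ?delta_norm_le// ltW.
  exists v; split; last by rewrite ballP.
  have vi : v ord0 i0 = t + e by rewrite !mxE !eqxx /= mulr1 curve_graph.
  by move: vi; rewrite /side /e /t; case: (b) => /= ->; lra.
have /choice[h hP] : forall l,
    exists h : ('rV[R]_n -> 'rV[R]_n) * ('rV[R]_n -> 'rV[R]_n),
    supp_homeo (ball (cube_center (tr (sigma l))) (cube_inner (tr (sigma l)))
      : set 'rV[R]_n) h.1 h.2 /\ forall bw, side l bw.1 (h.1 (pt l bw)).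
  move=> l; have [|h [h' hP]] := move_points i01 (ptI l) _ (fun bw => side_open l bw.1)
     (fun bw => side_meet l bw.1).
    by move=> bw; have [_ []] := margin0 l _ (time_lr l bw).
  by exists (h, h').
have [|l|M1 [M1' [M1S M1E]]] := @cubes_homeo R X n T (fun l => tr (sigma l))
    (fun l => (h l).1) (fun l => (h l).2) hX.
- by move=> l l' x xl xl'; apply: sI; exact: dis xl xl'.
- by apply: supp_homeo_sub (hP l).1; apply: le_ball; exact: ltW.
pose f0 := M1 \o g.
have f0_core l x : core (tr (sigma l)) (g x) -> core (tr (sigma l)) (f0 x).
  move=> gx; have [[fd _] fE] := M1E l _ (core_hull gx); split=> //.
  rewrite /f0 /= fE.
  have := @supp_homeo_stable _ _ _ _ (cube_map (tr (sigma l)) (g x)) (hP l).1.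
  by rewrite !ballP; apply; exact: gx.2.
have /choice[b1 b1P] : forall lbw : T * (bool * I), exists b : R, 0 < b /\
    forall v, `|v - curve (tr lbw.1) (time lbw.1 lbw.2)| <= b ->
      side lbw.1 lbw.2.1 (cube_map (tr (sigma lbw.1)) (f0 (cube_inv (tr lbw.1) v))).
  move=> [l bw] /=; set c := curve _ _.
  have [cin cco] := margin0 l _ (time_lr l bw).
  have [f0d _] := f0_core _ _ cco.
  have Fc : {for c, continuous (cube_map (tr (sigma l)) \o (f0 \o cube_inv (tr l)))}.
    apply: continuous_comp; last exact: chart_map_cts.
    apply: continuous_comp; first exact/chart_inv_cts/img.
    apply: continuous_comp; first exact: cg.
    by have [M1c _ _ _ _] := M1S; exact: M1c.
  have cs : side l bw.1 (cube_map (tr (sigma l)) (f0 (cube_inv (tr l) c))).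
    rewrite /f0 /= (M1E l _ (core_hull cco)).2; exact: (hP l).2.
  have /nbhs_ballP[e /= e0 eP] := Fc _ (open_nbhs_nbhs (conj (side_open l bw.1) cs)).
  exists (e / 2); split; first by rewrite divr_gt0.
  by move=> v vc; apply: (eP v); rewrite -ball_normE /= distrC; lra.
have [b0 b00 b0P] := finite_pos_lower_bound (fun lbw => (b1P lbw).1).
exists (Num.min b0 s); first by rewrite lt_min b00.
move=> beta /andP[beta0]; rewrite le_min => /andP[bb0 bs].
have /choice[S SP] : forall l,
  exists S : ('rV[R]_n -> 'rV[R]_n) * ('rV[R]_n -> 'rV[R]_n),
  [/\ supp_homeo (ball (cube_center (tr l)) (cube_outer (tr l)) : set 'rV[R]_n) S.1 S.2,
    forall x, S.1 x ord0 i0 = x ord0 i0 &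
    forall x, `|x - cube_center (tr l)| <= cube_inner (tr l) ->
      left_end (tr l) <= x ord0 i0 <= right_end (tr l) ->
      `|S.1 x - curve (tr l) (x ord0 i0)| < beta].
  move=> l; have [K curveK] := curve_lip (tr l).
  have [|S [S' SP]] := @squeeze_onto_curve R n i0 (cube_center (tr l)) _ _
    (curve (tr l)) K (left_end (tr l)) (right_end (tr l)) beta
    (cube_lt (tr l)) beta0 curveK (@curve_graph _ _ _ _ _ (tr l)).
    by move=> t /margin0[/ltW].
  by exists (S, S').
have [|M2 [M2' [M2S M2E]]] := @cubes_homeo R X n T tr
    (fun l => (S l).1) (fun l => (S l).2) hX dis.
  by move=> l; have [] := SP l.
have low_high l x b : core (tr (sigma l)) (f0 x) ->
    side l b (cube_map (tr (sigma l)) (f0 x)) ->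
    side l b (cube_map (tr (sigma l)) (M2 (f0 x))).
  move=> fx; rewrite (M2E _ _ (core_hull fx)).2.
  by have [_ Si0 _] := SP (sigma l); case: b; rewrite /side /= Si0.
have tubeP l x t t' : left_end (tr l) <= t -> t' <= right_end (tr l) ->
    tube (tr l) beta t t' x -> core (tr (sigma l)) (f0 x).
  move=> lt rt [xd [xt xb]]; apply: f0_core.
  have [||_] := margin l (cube_map (tr l) x ord0 i0) (cube_map (tr l) x).
  - by move: xt; lra.
  - exact: le_trans bs.
  by rewrite /cube_inv /cube_map chart_mapK.
have faceP l b w x : tube (tr l) beta (time l (b, w)) (time l (b, w)) x ->
    side l b (cube_map (tr (sigma l)) (M2 (f0 x))).
  move=> xtube; have /andP[tl tr_] := time_lr l (b, w).
  apply: low_high; first exact: tubeP tl tr_ xtube.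
  have [xd [xt xb]] := xtube; have [_ /(_ (cube_map (tr l) x))] := b1P (l, (b, w)).
  rewrite /cube_inv /cube_map chart_mapK//; apply.
  have <- : cube_map (tr l) x ord0 i0 = time l (b, w) by apply/eqP; rewrite eq_le andbC.
  by apply: le_trans xb _; apply: le_trans bb0 (b0P _).
have dom l x t t' : left_end (tr l) <= t -> t' <= right_end (tr l) ->
    tube (tr l) beta t t' x -> chart_dom (cube_chart (tr (sigma l))) (M2 (f0 x)).
  by move=> lt rt /(tubeP _ _ _ _ lt rt)/core_hull/M2E[[]].
exists (M2 \o M1), (M1' \o M2'); split.
- apply: supp_homeo_comp M2S; apply: supp_homeo_sub M1S.
  by move=> x [l _ xl]; exists (sigma l).
- have [tau _ sK] := injF_bij sI.
  move=> l x xl; rewrite -(sK l) in xl *.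
  by apply: (M2E _ _ _).1; exact: (M1E _ _ xl).1.
move=> l w; have [/andP[w1 w2] w3] := ee l w; split=> x xt.
- have := tubeP _ _ _ _ (ltW w1) (ltW w3) xt; move=> fx; split.
    exact: dom (ltW w1) (ltW w3) xt.
  have [_ Si0 Sb] := SP (sigma l).
  rewrite /= -/(f0 x) (M2E _ _ (core_hull fx)).2 Si0.
  set z := cube_map _ _; have [zl|zl] := ltP (z ord0 i0) (left_end (tr (sigma l))).
    by left.
  have [zr|zr] := ltP (right_end (tr (sigma l))) (z ord0 i0); first by right; left.
  by right; right; apply: Sb; [exact: ltW fx.2|rewrite zl].
- split; first by apply: dom xt; lra.
  exact: (faceP l false w).
- split; first by apply: dom xt; lra.
  exact: (faceP l true w).
Qed.

(** * Genericity *)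

Lemma compact_uniform_continuity (R : realType) (X : metricType R) (f : X -> X)
    (e : R) : compact [set: X] -> continuous f -> 0 < e ->
  exists2 d, 0 < d & forall x y, mdist x y < d -> mdist (f x) (f y) < e.
Proof.
move=> /compact_near_coveringP cX cf e0.
have : \forall d \near (0:R)^'+,
    [set: X] `<=` [set x | forall y, mdist x y < d -> mdist (f x) (f y) < e].
  apply: (cX) => x _.
  have e2 : 0 < e / 2 by rewrite divr_gt0.
  have /nbhs_ballP[d /= d0 df] : nbhs x [set y | mdist (f x) (f y) < e / 2].
    have := cf x _ (nbhsx_ballx (f x) _ e2).
    by rewrite nbhs_filterE ballEmdist.
  exists (ball x (d / 2), [set d' | d' < d / 2]) => /=.
    split; first by apply: nbhsx_ballx; rewrite divr_gt0.
    by apply: nbhs_right_lt; rewrite divr_gt0.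
  have dfP w : mdist x w < d -> mdist (f x) (f w) < e / 2.
    by move=> xw; apply: df; rewrite ballEmdist.
  move=> [z d'] /= [+ d'd] y zy; rewrite ballEmdist /= => xz.
  have {}d'd : d' < d / 2 by exact: d'd.
  have xzd : mdist x z < d by lra.
  have xyd : mdist x y < d by have := metric_triangle x z y; lra.
  have := dfP _ xzd; have := dfP _ xyd; have := metric_triangle (f z) (f x) (f y).
  rewrite (metric_sym (f z) (f x)); lra.
rewrite /at_right => /nbhs_ballP[d /= d0 H]; exists (d / 2).
  by rewrite divr_gt0.
move=> x y; apply: (H (d / 2)) => //=; last by rewrite divr_gt0.
rewrite -ball_normE /= sub0r normrN gtr0_norm ?divr_gt0//.
by rewrite ltr_pdivrMr// ltr_pMr// ltr1n.
Qed.

(** At scale [c / M], a horseshoe with [M ^ n] pieces has entropy at least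
    [n * ln M], which is [n * |ln (c / M)|] up to a bounded error. *)
Lemma fine_scale (R : realType) (n : nat) (kappa c b : R) :
  0 < kappa <= n%:R -> 0 < c -> 0 < b -> exists m : nat,
  [/\ 0 < c / m.+1%:R < 1, c / m.+1%:R < b &
      (n%:R - kappa) * `|ln (c / m.+1%:R)| <= n%:R * ln (m.+1%:R : R)].
Proof.
move=> /andP[k0 kn] c0 b0; pose a := n%:R * `|ln c| / kappa.
have a0 : 0 <= a by rewrite divr_ge0 ?mulr_ge0// ltW.
pose z := c + c / b + expR a.
have cb0 : 0 < c / b by rewrite divr_gt0.
have ea0 : 0 < expR a by exact: expR_gt0.
have z0 : 0 <= z by rewrite /z; lra.
pose m := Num.bound z; exists m.
have M0 : 0 < m.+1%:R :> R by rewrite ltr0n.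
have zm : z < m.+1%:R by apply: lt_trans (archi_boundP z0) _; rewrite ltr_nat.
have cM1 : c / m.+1%:R < 1 by rewrite ltr_pdivrMr// mul1r; move: zm; rewrite /z; lra.
have cM0 : 0 < c / m.+1%:R by rewrite divr_gt0.
split; first by rewrite cM0.
  by rewrite ltr_pdivrMr// mulrC -ltr_pdivrMr//; move: zm; rewrite /z; lra.
rewrite ltr0_norm ?ln_lt0 ?cM0// ln_div ?posrE// opprB.
have aM : a <= ln m.+1%:R.
  by rewrite -ler_expR lnK ?posrE//; move: zm; rewrite /z; lra.
have : kappa * a = n%:R * `|ln c| by rewrite /a mulrC divfK// gt_eqF.
have : kappa * a <= kappa * ln m.+1%:R by rewrite ler_pM2l.
have : - (n%:R - kappa) * ln c <= n%:R * `|ln c|.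
  have nk : 0 <= n%:R - kappa by rewrite subr_ge0.
  rewrite mulNr -mulrN; apply: (@le_trans _ _ ((n%:R - kappa) * `|ln c|)).
    by rewrite ler_wpM2l// -normrN ler_norm.
  by rewrite ler_wpM2r// gerBl ltW.
lra.
Qed.

Section Genericity.
Context {R : realType} {n : nat} {X : metricType R} {cX : compact [set: X]}.
Variables (A F : set (chart R X n)) (i0 i1 : 'I_n).
Hypotheses (i01 : i0 != i1) (X0 : [set: X] !=set0).
Hypothesis AF : bilipschitz_smooth_atlas A F.

Definition large_entropy (k : nat) (f : X -> X) := exists2 eps : R,
  0 < eps < k.+1%:R^-1 /\ eps < 1 &
  (((n%:R - k.+1%:R^-1) * `|ln eps|)%:E <= eps_entropy f eps)%E.

Lemma homeo_dist_le (f g : Homeo cX) (d : R) :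
  (forall x, mdist (f x) (g x) <= d /\ mdist (homeo_inv f x) (homeo_inv g x) <= d) ->
  homeo_dist f g <= d.
Proof.
move=> fg; have [x0 _] := X0; apply: ge_sup => [|_ [x _ <-]].
  by eexists; exists x0.
by rewrite ge_max; have [-> ->] := fg x.
Qed.

(** The size [r], at which [g] is known to map a cube into the next one, is fixed
    before the number of branches: by [fine_scale] it costs only a bounded error,
    which becomes negligible when the number of branches is large. *)
Lemma robust_large_entropy_dense (k : nat) (g : Homeo cX) (d : R) : 0 < d ->
  exists f : Homeo cX, homeo_dist g f < d /\
    exists2 eta : R, 0 < eta & forall f' : Homeo cX, homeo_dist f f' < eta ->
      large_entropy k f'.
Proof.
move=> d0.
have n0 : (0 < n)%N by apply: leq_ltn_trans (ltn_ord i0).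
have [N [phi [L [B [[L1 _] cov lip _]]]]] := uniform_atlas cX AF.
have L0 : 0 < L by apply: lt_le_trans L1.
have d20 : 0 < d / 2 by rewrite divr_gt0.
have [d1 d10 gd1] := compact_uniform_continuity cX (@homeo_inv_continuous _ _ _ g) d20.
have gI : injective g := can_inj (@homeo_funK _ _ _ g).
have d'0 : 0 < Num.min d1 (d / 2) by rewrite lt_min d10.
have [p [C [y [sigma [sI Cphi Cy Cd dis]]]]] :=
  cycle_of_cubes cX L1 cov lip gI X0 d'0.
pose e l := cube_map (C l) (y l).
have /choice[rr rrP] : forall l, exists r : R, 0 < r /\ forall v, `|v - e l| <= r ->
    `|v - cube_center (C l)| < cube_inner (C l) /\
    core (C (sigma l)) (g (cube_inv (C l) v)).
  move=> l; have [[yd yC] gyC] := Cy l.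
  have eimg : chart_img (cube_chart (C l)) (e l) by exists (y l).
  have gc : {for e l, continuous (g \o cube_inv (C l))}.
    by apply: continuous_comp; [exact: chart_inv_cts|exact: homeo_fun_continuous].
  have /nbhs_ballP[r /= r0 rP] : nbhs (e l)
      [set v | `|v - cube_center (C l)| < cube_inner (C l) /\
      core (C (sigma l)) (g (cube_inv (C l) v))].
    apply: filterI; first by apply: open_nbhs_nbhs; split; [exact: norm_ball_open|].
    apply: (gc (core (C (sigma l)))); apply: open_nbhs_nbhs.
    by split; [exact: core_open|rewrite /e /= /cube_inv /cube_map chart_mapK].
  exists (r / 2); split; first by rewrite divr_gt0.
  by move=> v vr; apply: rP; rewrite -ball_normE /= distrC; lra.
have [r r0 rle] := finite_pos_lower_bound (fun l => (rrP l).1).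
have rP l v : `|v - e l| <= r -> `|v - cube_center (C l)| < cube_inner (C l) /\
    core (C (sigma l)) (g (cube_inv (C l) v)).
  by move=> vr; apply: (rrP l).2; exact: le_trans vr (rle l).
have k1 : 0 < (k.+1%:R^-1 : R) by rewrite invr_gt0.
have [||m [/andP[eps0 eps1] epsk epsn]] :=
  @fine_scale R n k.+1%:R^-1 (r / (8 * L)) k.+1%:R^-1 _ _ k1.
- rewrite k1 (@le_trans _ _ 1)// ?ler1n//.
  by rewrite invf_le1// ler1n.
- by rewrite divr_gt0// mulr_gt0.
set eps := r / _ / _ in eps0 eps1 epsk epsn.
pose M : R := m.+1%:R; have M0 : 0 < M by rewrite ltr0n.
pose I : finType := {ffun 'I_n -> 'I_m.+1}.
have /choice[tr trP] : forall l, exists tr : track R X i0 I,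
  [/\ track_cube tr = C l,
      left_end tr = e l ord0 i0 - r / 2 /\ right_end tr = e l ord0 i0 + r / 2,
      forall t, left_end tr <= t <= right_end tr -> `|curve tr t - e l| <= r / 2 &
      forall w w' t t', w != w' -> entry tr w <= t <= exit tr w ->
        entry tr w' <= t' <= exit tr w' ->
        r / (2 * M) <= `|curve tr t - curve tr t'|].
  move=> l; have [c [K [en [ex [cK cg cr cee csep]]]]] := grid_curve i0 (e l) m r0.
  have lr : e l ord0 i0 - r / 2 < e l ord0 i0 + r / 2 by lra.
  exists (Track (C l) (ex_intro _ K cK) cg lr cee); split=> //= t tlr.
  by apply: cr; rewrite ler_norml; lra.
have margin l t v : left_end (tr l) <= t <= right_end (tr l) ->
    `|v - curve (tr l) t| <= r / 2 ->
    `|v - cube_center (tr l)| < cube_inner (tr l) /\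
    core (tr (sigma l)) (g (cube_inv (tr l) v)).
  have [-> _ ce _] := trP l; have [-> _ _ _] := trP (sigma l).
  move=> /ce tc vc; apply: rP.
  have -> : v - e l = (v - curve (tr l) t) + (curve (tr l) t - e l) by rewrite addrA subrK.
  by rewrite [leRHS]splitr (le_trans (ler_normD _ _))// lerD.
have hullE l x : hull (tr l) x = hull (C l) x by have [-> _ _ _] := trP l.
have r20 : 0 < r / 2 by rewrite divr_gt0.
have [|||b0 b00 b0P] := @perturb_to_horseshoe R X n i0 i1 I _ tr sigma g (r / 2)
  i01 sI (@homeo_fun_continuous _ _ _ g) gI r20.
- by move=> l l' x; rewrite !hullE; exact: dis.
- exact: margin.
- move=> l w w' t tw tw'; apply/eqP/negPn/negP => ww'; have [_ _ _ sep] := trP l.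
  have := sep _ _ _ _ ww' tw tw'; rewrite subrr normr0 leNgt => /negP; apply.
  by rewrite divr_gt0// mulr_gt0.
(* The pieces of the curve are [r / (2 * M)] apart, and tubes of this thickness
   around them keep half of this separation; [8 * L] in the choice of [eps] allows
   for a factor 2 more, and for the passage from charts to the distance of [X]. *)
pose beta := Num.min b0 (Num.min (r / (8 * M)) (r / 2)).
have rM0 : 0 < r / (8 * M) by rewrite divr_gt0// mulr_gt0.
have beta0 : 0 < beta by rewrite !lt_min b00 r20 rM0.
have [bb0 bM br] : [/\ beta <= b0, beta <= r / (8 * M) & beta <= r / 2].
  by rewrite /beta !ge_min !lexx !orbT.
have [|M1 [M1' [M1S M1h M1a]]] := b0P beta; first by rewrite beta0.
have [c1 c1' K1 K1' S1] := M1S.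
have fc : continuous (M1 \o g).
  by move=> x; apply: continuous_comp; [exact: homeo_fun_continuous|exact: c1].
have fc' : continuous (homeo_inv g \o M1').
  by move=> x; apply: continuous_comp; [exact: c1'|exact: homeo_inv_continuous].
have fK : cancel (M1 \o g) (homeo_inv g \o M1').
  by move=> x /=; rewrite K1 homeo_funK.
have fK' : cancel (homeo_inv g \o M1') (M1 \o g).
  by move=> x /=; rewrite homeo_invK K1'.
pose f : Homeo cX := MkHomeo cX fc fc' fK fK'.
have M1d x : mdist x (M1 x) < Num.min d1 (d / 2).
  have [[l _ xl]|nx] := pselect ((\bigcup_l hull (tr l)) x); last first.
    by rewrite S1// mdistxx.
  by apply: (Cd l); rewrite -hullE//; exact: M1h.
exists f; split.
  apply: (@le_lt_trans _ _ (d / 2)); last by lra.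
  apply: homeo_dist_le => x /=; split.
    by apply: ltW; apply: lt_le_trans (M1d _) _; rewrite ge_min lexx orbT.
  apply/ltW/gd1; rewrite -{1}(K1' x) metric_sym; apply: lt_le_trans (M1d _) _.
  by rewrite ge_min lexx.
have margin' l t v : left_end (tr l) <= t <= right_end (tr l) ->
    `|v - curve (tr l) t| <= beta -> `|v - cube_center (tr l)| < cube_inner (tr l).
  by move=> tlr vb; have [] := margin l t v tlr (le_trans vb br).
have [eta eta0 etaP] := maps_across_robust cX margin' fc M1a.
exists eta => // f' ff'; exists eps; first by rewrite eps0.
have I0 : (0 < #|I|)%N by rewrite card_ffun card_ord expn_gt0.
have fa : maps_across tr sigma beta f'.
  by apply: etaP => x; apply: le_lt_trans ff'; have [] := homeo_dist_ge f f' x.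
apply: le_trans (@maps_across_entropy _ _ _ _ _ _ tr sigma beta f' eps ord0
  eps0 I0 (ltW beta0) margin' _ (@homeo_fun_continuous _ _ _ f') fa).
  rewrite lee_fin card_ffun !card_ord natrX lnXn//.
  by rewrite -[ln _ *+ n]mulr_natl.
move=> l w w' x x' ww' [xd [xw xb]] [x'd [x'w x'b]].
have [cE _ _ sep] := trP l; have := sep _ _ _ _ ww' xw x'w.
set u := cube_map _ x in xw xb *; set u' := cube_map _ x' in x'w x'b *.
move=> sep'.
have uu : 2 * (r / (8 * M)) <= `|u - u'|.
  have uE : curve (tr l) (u ord0 i0) - curve (tr l) (u' ord0 i0) =
    (u - u') - (u - curve (tr l) (u ord0 i0)) + (u' - curve (tr l) (u' ord0 i0)).
    by apply/rowP => j; rewrite !mxE; ring.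
  have rE : r / (2 * M) = 4 * (r / (8 * M)) by field; rewrite gt_eqF.
  have qE : 4 * (r / (8 * M)) = 2 * (r / (8 * M)) + r / (8 * M) + r / (8 * M) by ring.
  rewrite -(lerD2r (r / (8 * M))) -(lerD2r (r / (8 * M))) -qE -rE.
  apply: le_trans sep' _; rewrite uE (le_trans (ler_normD _ _))//.
  apply: lerD (le_trans x'b bM); apply: le_trans (ler_normB _ _) _.
  by rewrite lerD2l; exact: le_trans xb bM.
have [k' Ck] := Cphi l.
have := lip k' x x'; rewrite -Ck -cE => /(_ xd x'd)[_ uL].
have LE : L * eps = r / (8 * M) by rewrite /eps -/M; field; rewrite ?gt_eqF.
rewrite -(ltr_pM2l L0) LE; apply: lt_le_trans (le_trans uu uL).
by rewrite ltr_pMl// ltr1n.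
Qed.

End Genericity.

Theorem theorem1 (R : realType) (n : nat) (X : metricType R)
    (cX : compact [set: X]) (A : set (chart R X n)) :
  (1 < n)%N ->
  [set: X] !=set0 -> connected [set: X] ->
  smooth_atlas A ->
  (exists F : set (chart R X n), bilipschitz_smooth_atlas A F) ->
  exists S : set (Homeo cX),
    Baire_residual S /\ forall f : Homeo cX, S f -> upper_mdim f = (n%:R)%:E.
Proof.
move=> n1 X0 _ _ [F AF].
have n0 : (0 < n)%N by exact: ltnW.
have i01 : Ordinal n0 != Ordinal n1 by [].
pose U k : set (Homeo cX) := [set f : Homeo cX | large_entropy (n := n) k f]^°.
exists (\bigcap_k U k); split.
  exists U; split=> // k; split; first exact: open_interior.
  move=> O [g Og] oO; have /nbhs_ballP[d /= d0 gO] : nbhs g O by exact: open_nbhs_nbhs.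
  have [f [gf [eta eta0 fP]]] := robust_large_entropy_dense i01 X0 AF k g d0.
  exists f; split; first by apply: gO; rewrite ballEmdist.
  apply/nbhs_ballP; exists eta => //= f'; rewrite ballEmdist => ff'; exact: fP.
move=> f Uf; apply/eqP; rewrite eq_le (upper_mdim_le f X0 cX AF) /=.
rewrite /upper_mdim limf_esupE; apply: le_ereal_inf_tmp => _ [V V0 <-].
apply/lee_addgt0Pr => e e0.
have /nbhs_ballP[d /= d0 dV] := V0.
have de0 : 0 < Num.min d e by rewrite lt_min d0.
have [k kde] : exists k : nat, k.+1%:R^-1 < Num.min d e.
  have dei : 0 <= (Num.min d e)^-1 by rewrite invr_ge0 ltW.
  exists (Num.bound (Num.min d e)^-1).
  rewrite invf_plt ?posrE//; apply: lt_trans (archi_boundP dei) _.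
  by rewrite ltr_nat.
have [eps [/andP[eps0 epsk] eps1] epsh] := interior_subset (Uf k I).
move: kde; rewrite lt_min => /andP[kd ke].
have lneps : 0 < `|ln eps| by rewrite normr_gt0 lt_eqF// ln_lt0 ?eps0.
have Veps : V eps.
  apply: dV => //; rewrite -ball_normE /= sub0r normrN gtr0_norm//.
  exact: lt_trans epsk kd.
apply: (@le_trans _ _ (eps_entropy f eps / (`|ln eps|)%:E + e%:E)%E); last first.
  by apply: leeD2r; apply: ereal_sup_ubound; exists eps.
rewrite -leeBlDr// inver gt_eqF// lee_pdivlMr// -EFinB -EFinM.
apply: le_trans epsh; rewrite lee_fin ler_wpM2r// lerD2l lerN2.
exact: ltW.
Qed.
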